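(* For all $c\in\mathbb{C}$ with $\operatorname{Re}(c)>0$ and all $\tau\in S_c$, the integral operator on $L^2(\mathbb{R})$ $$A_{c,\tau}f(x)=\int_{\mathbb{R}}K_c(\tau,x,y)f(y)\,dy$$ is of Hilbert–Schmidt type, and: 1. For $c$ fixed, $A_{c,\tau}$ is norm continuous for $\tau\in S_c$ and holomorphic for $\tau$ in the interior of $S_c$. 2. For $\tau>0$ fixed, $A_{c,\tau}$ is a holomorphic family of bounded operators for $\operatorname{Re}(c)>0$.
   Context: For $\operatorname{Re}(c)>0$ and $\tau\in S_c$, $$K_c(\tau,x,y)=w_1\exp\left[w_3xy-w_2(x^2+y^2)\right]\qquad(x,y\in\mathbb{R}),$$ with $$\lambda=\exp[-2c^{1/2}\tau],\quad w_1=c^{1/4}\lambda^{1/2}[\pi(1-\lambda^2)]^{-1/2},\quad w_2=\frac{c^{1/2}(1+\lambda^2)}{2(1-\lambda^2)},\quad w_3=\frac{2c^{1/2}\lambda}{1-\lambda^2}.$$ Powers of $c$ and of $1-\lambda^2$ are principal branches ($|\lambda|<1$ for $\tau\in S_c$), and $\lambda^{1/2}=\exp[-c^{1/2}\tau]$. With $S(-\alpha,\beta)=\{z\in\mathbb{C}: -\alpha<\arg z<\beta\}$, $$S_c=\begin{cases}\overline{S(-\frac{\pi}{2},\frac{\pi}{2}-\arg(c))}\setminus\{0\}&\text{if }\operatorname{Im}(c)>0,\\ S(-\frac{\pi}{2},\frac{\pi}{2})&\text{if }\operatorname{Im}(c)=0,\\ \overline{S(-\frac{\pi}{2}-\arg(c),\frac{\pi}{2})}\setminus\{0\}&\text{if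 }\operatorname{Im}(c)<0.\end{cases}$$ Here $S(-\frac{\pi}{2}-\arg(c),\frac{\pi}{2})=\{z:-\frac{\pi}{2}-\arg(c)<\arg z<\frac{\pi}{2}\}$. *)

(* Defs.v *)
From HB Require Import structures.
From mathcomp Require Import all_boot all_order all_algebra.
From mathcomp Require Import all_classical all_reals all_analysis.
From mathcomp Require Import complex.

Set Implicit Arguments.
Unset Strict Implicit.
Unset Printing Implicit Defensive.

Import Order.TTheory GRing.Theory Num.Theory.
Import numFieldNormedType.Exports.
Import ComplexField.Normc.

Local Notation Re := complex.Re.
Local Notation Im := complex.Im.

Local Open Scope classical_set_scope.
Local Open Scope ring_scope.
Local Open Scope complex_scope.

Section ComplexFunctions.
Context {R : realType}.
Implicit Types (z c tau : R[i]) (a b : R).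

Definition cexp z : R[i] :=
  (expR (Re z) * cos (Im z)) +i* (expR (Re z) * sin (Im z)).

(* principal argument, in ]-pi, pi] ; the value at z = 0 is meaningless *)
Definition arg z : R :=
  if 0 <= Im z then acos (Re z / normc z) else - acos (Re z / normc z).

Definition clog z : R[i] := ln (normc z) +i* arg z.

(* principal branch of z^a for z != 0 *)
Definition cpow z a : R[i] := cexp (a%:C * clog z).

(* S(a, b) = {z | a < arg z < b}; the regular type R[i]^o carries the usual
   topology of the complex plane *)
Definition sector a b : set R[i]^o :=
  [set z : R[i]^o | z != 0 /\ a < arg z < b].

Definition S_ c : set R[i]^o :=
  if 0 < Im c then closure (sector (- (pi / 2)) (pi / 2 - arg c)) `\ 0
  else if Im c < 0 then closure (sector (- (pi / 2) - arg c) (pi / 2)) `\ 0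
  else sector (- (pi / 2)) (pi / 2).

Definition lam c tau : R[i] := cexp (- (2 * cpow c 2^-1 * tau)).

(* the factor lam^(1/2) of w1 is exp(- c^(1/2) tau), which need not be the
   principal square root of lam *)
Definition w1 c tau : R[i] :=
  cpow c 4^-1 * cexp (- (cpow c 2^-1 * tau)) *
  cpow (pi%:C * (1 - lam c tau ^+ 2)) (- 2^-1).
Definition w2 c tau : R[i] :=
  cpow c 2^-1 * (1 + lam c tau ^+ 2) / (2 * (1 - lam c tau ^+ 2)).
Definition w3 c tau : R[i] :=
  2 * cpow c 2^-1 * lam c tau / (1 - lam c tau ^+ 2).

Definition K c tau (x y : R) : R[i] :=
  w1 c tau *
  cexp (w3 c tau * (x * y)%:C - w2 c tau * (x ^+ 2 + y ^+ 2)%:C).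

End ComplexFunctions.

(* L^2(R) is represented by square-integrable functions R -> R[i], without
   passing to the quotient by equality almost everywhere; an operator is a map
   on functions, and bounded_operator requires it to respect a.e. equality. *)
Section L2.
Context {R : realType}.
Local Notation mu := (@lebesgue_measure R).
Implicit Types (f g : R -> R[i]) (T : (R -> R[i]) -> (R -> R[i])).

Definition cintegrable f : Prop :=
  mu.-integrable setT (EFin \o (fun x => Re (f x))) /\
  mu.-integrable setT (EFin \o (fun x => Im (f x))).

Definition cintegral f : R[i] :=
  (\int[mu]_x Re (f x))%R +i* (\int[mu]_x Im (f x))%R.

Definition L2norm f : \bar R := Lnorm mu 2%:E (fun x => (normc (f x))%:E).

Definition L2 f : Prop :=
  [/\ measurable_fun setT (fun x => Re (f x)),
      measurable_fun setT (fun x => Im (f x)) &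
      (L2norm f < +oo)%E].

Definition L2dot f g : R[i] := cintegral (fun x => f x * (g x)^*).

Definition opnorm T : \bar R :=
  ereal_sup [set L2norm (T f) | f in [set f | L2 f /\ (L2norm f <= 1)%E]].

Definition bounded_operator T : Prop :=
  [/\ forall f, L2 f -> L2 (T f),
      forall f g, L2 f -> L2 g ->
        {ae mu, forall x, f x = g x} -> {ae mu, forall x, T f x = T g x},
      forall (a : R[i]) f g, L2 f -> L2 g ->
        {ae mu, forall x, T (fun y => a * f y + g y) x = a * T f x + T g x} &
      (opnorm T < +oo)%E].

Definition orthonormal (B : set (R -> R[i])) : Prop :=
  (forall e, B e -> L2 e /\ L2dot e e = 1) /\
  (forall e e', B e -> B e' -> e <> e' -> L2dot e e' = 0).

(* a maximal orthonormal set *)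
Definition orthonormal_basis (B : set (R -> R[i])) : Prop :=
  orthonormal B /\
  forall f, L2 f -> (forall e, B e -> L2dot f e = 0) ->
    {ae mu, forall x, f x = 0}.

Definition hilbert_schmidt T : Prop :=
  bounded_operator T /\
  exists2 B, orthonormal_basis B & (\esum_(e in B) (L2norm (T e) ^+ 2) < +oo)%E.

Definition integral_operator (k : R -> R -> R[i]) f : R -> R[i] :=
  fun x => cintegral (fun y => k x y * f y).

(* the integral defining the operator converges absolutely *)
Definition integral_operator_defined (k : R -> R -> R[i]) : Prop :=
  forall f, L2 f -> forall x, cintegrable (fun y => k x y * f y).

Definition norm_continuous_on (D : set R[i]^o)
    (F : R[i] -> (R -> R[i]) -> (R -> R[i])) : Prop :=
  forall z : R[i]^o, D z ->
    bounded_operator (F z) /\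
    opnorm (fun f x => F w f x - F z f x) @[w --> within D (nbhs z)] --> 0%E.

(* complex differentiability in operator norm; meant for U open *)
Definition norm_holomorphic_on (U : set R[i]^o)
    (F : R[i] -> (R -> R[i]) -> (R -> R[i])) : Prop :=
  forall z : R[i]^o, U z ->
    bounded_operator (F z) /\
    exists2 F' : (R -> R[i]) -> (R -> R[i]), bounded_operator F' &
      opnorm (fun f x => (F w f x - F z f x) / (w - z) - F' f x)
        @[w --> z^'] --> 0%E.

End L2.

Definition A {R : realType} (c tau : R[i]) : (R -> R[i]) -> (R -> R[i]) :=
  integral_operator (K c tau).

(* Main.v *)
Require Import Defs.
From HB Require Import structures.
From mathcomp Require Import all_boot all_order all_algebra.
From mathcomp Require Import all_classical all_reals all_analysis.
From mathcomp Require Import complex.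
From mathcomp Require Import measurable_realfun ring lra.

(* Write [s = c^(1/2) = p + iq] and [s tau = a + ib]. The exponent of [K] is the
   quadratic form [w3 xy - w2 (x^2 + y^2)], whose real part is negative definite
   iff [|Re w3| / 2 < Re w2]; since [w2 -+ w3 / 2 = (s / 2) ((1 - lam) / (1 + lam))^(+-1)],
   this amounts to [2 |q Im lam| < p (1 - |lam|^2)]. On [S_ c] both [Re tau] and
   [Re (c tau)] are nonnegative, which says [|bq| <= ap], and the inequality then
   follows from [|sin 2b| <= 2 |b|] and [sinh 2a > 2a].

   A continuous kernel bounded by [M exp(- d (x^2 + y^2))] gives a Hilbert-Schmidt
   operator of norm at most [M] times the integral of [exp(- 2 d x^2)]. The weights
   are holomorphic at every admissible point, boundary points of [S_ c] included,
   so Taylor's formula for [exp] bounds the difference quotient of the kernels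
   minus the derivative kernel by [e C exp(- d (x^2 + y^2))] with [e] arbitrarily
   small. This yields norm continuity and both holomorphy statements. *)

Import Order.TTheory GRing.Theory Num.Theory.
Import numFieldNormedType.Exports.
Import ComplexField.Normc.
Local Open Scope classical_set_scope.
Local Open Scope ring_scope.
Local Open Scope complex_scope.
Local Notation Re := complex.Re.
Local Notation Im := complex.Im.

(** * Complex numbers *)

Section ComplexBasics.
Context {R : realType}.
Implicit Types (z w : R[i]) (a b x : R).

(** All estimates live at one point [z]: they use differentiability of the three weights at [z] and
    the strict inequality at [z], and conclude on a full neighbourhood, so the limit along [S_ c] is
    a mere restriction. The weights are followed along arbitrary functions [cf] and [tf] of one
    parameter, so a single statement serves variation in tau and variation in c.

    The half-plane conditions enter through the identities ap + bq = |s|^2 Re tau and ap - bq = Re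
    (c tau).

    Images under the operators must be shown measurable. Joint measurability of the kernel is
    avoided: kernels are continuous in each variable, and dominated convergence makes the image of
    every L2 function continuous.

    The derivative kernel carries a factor polynomial in x^2 + y^2, and the increment of the
    exponent also grows like x^2 + y^2. Both are paid for by giving up half of the Gaussian decay
    rate. *)

Lemma normc_ge0 z : 0 <= normc z.
Proof. by case: z => a b; exact: sqrtr_ge0. Qed.

Lemma sqr_normcE z : normc z ^+ 2 = Re z ^+ 2 + Im z ^+ 2.
Proof. by case: z => a b /=; rewrite sqr_sqrtr// addr_ge0 ?sqr_ge0. Qed.

Lemma ler_Re_normc z : `|Re z| <= normc z.
Proof.
rewrite -(ler_pXn2r (n := 2))// ?nnegrE ?normr_ge0 ?normc_ge0//.
by rewrite sqr_normcE real_normK ?num_real// lerDl sqr_ge0.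
Qed.

Lemma ler_Im_normc z : `|Im z| <= normc z.
Proof.
rewrite -(ler_pXn2r (n := 2))// ?nnegrE ?normr_ge0 ?normc_ge0//.
by rewrite sqr_normcE real_normK ?num_real// lerDr sqr_ge0.
Qed.

Lemma ler_normcReIm z : normc z <= `|Re z| + `|Im z|.
Proof.
rewrite -(ler_pXn2r (n := 2))// ?nnegrE ?normc_ge0 ?addr_ge0//.
rewrite sqr_normcE sqrrD !real_normK ?num_real//.
by rewrite addrAC lerDl mulrn_wge0// mulr_ge0.
Qed.

Lemma normc_eq0 z : (normc z == 0) = (z == 0).
Proof. by apply/eqP/eqP => [/eq0_normc//|->]; exact: normc0. Qed.

Lemma normc_gt0 z : (0 < normc z) = (z != 0).
Proof. by rewrite lt_def normc_ge0 andbT normc_eq0. Qed.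

Lemma normcR a : normc a%:C = `|a|.
Proof. by rewrite /= expr0n addr0 sqrtr_sqr. Qed.

Lemma normc_distC z w : normc (z - w) = normc (w - z).
Proof. by rewrite -opprB normcN. Qed.

Lemma normcX z n : normc (z ^+ n) = normc z ^+ n.
Proof. by elim: n => [|n IH]; rewrite ?expr0 ?normc1// !exprS normcM IH. Qed.

Lemma cReM z w : Re (z * w) = Re z * Re w - Im z * Im w.
Proof. by case: z w => [? ?] [? ?]. Qed.

Lemma cImM z w : Im (z * w) = Re z * Im w + Im z * Re w.
Proof. by case: z w => [? ?] [? ?]. Qed.

Lemma cReD z w : Re (z + w) = Re z + Re w.
Proof. by case: z w => [? ?] [? ?]. Qed.

Lemma cImD z w : Im (z + w) = Im z + Im w.
Proof. by case: z w => [? ?] [? ?]. Qed.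

Lemma cReN z : Re (- z) = - Re z.
Proof. by case: z. Qed.

Lemma cImN z : Im (- z) = - Im z.
Proof. by case: z. Qed.

Lemma cReJ z : Re (z^*) = Re z.
Proof. by case: z. Qed.

Lemma cImJ z : Im (z^*) = - Im z.
Proof. by case: z. Qed.

Lemma normcJE z : normc (z^*) = normc z.
Proof. by case: z => a b; rewrite /= sqrrN. Qed.

Definition cReImE := (cReD, cImD, cReN, cImN, cReM, cImM, cReJ, cImJ).

Lemma complexP z w : Re z = Re w -> Im z = Im w -> z = w.
Proof. by case: z w => [? ?] [? ?] /= -> ->. Qed.

(** Balls of [R[i]^o] have radii in [R[i]]; a positive element of [R[i]] is real, so real radii
    suffice. *)
Lemma near_normcP (z : R[i]^o) (P : R[i] -> Prop) :
  (\forall w \near z, P w) <->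
  exists2 d : R, 0 < d & forall w, normc (w - z) < d -> P w.
Proof.
split=> [/nbhs_ballP[e /= e0 He]|[d d0 Hd]].
  have eE : e = (Re e)%:C by rewrite RRe_real// gtr0_real.
  exists (Re e) => [|w wz]; first by rewrite -ltcR -eE.
  apply: He; rewrite -ball_normE /= distrC.
  by rewrite [e]eE normc_def ltcR -[X in X < _](_ : normc (w - z) = _)//; case: (w - z).
apply/nbhs_ballP; exists (d%:C) => /=; first by rewrite ltcR.
move=> w; rewrite -ball_normE /= distrC normc_def ltcR => wz.
by apply: Hd; move: wz; case: (w - z).
Qed.

Lemma cexpD z w : cexp (z + w) = cexp z * cexp w.
Proof.
case: z w => [a b] [c d]; apply: complexP; rewrite /cexp /= expRD.
  by rewrite cosD; ring.
by rewrite sinD; ring.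
Qed.

Lemma cexp0 : cexp 0 = 1 :> R[i].
Proof. by rewrite /cexp /= expR0 cos0 sin0 mulr1 mulr0. Qed.

Lemma normc_cexp z : normc (cexp z) = expR (Re z).
Proof.
apply/eqP; rewrite -(eqrXn2 (n := 2))// ?normc_ge0 ?expR_ge0// sqr_normcE /=.
by rewrite !exprMn -mulrDr cos2Dsin2 mulr1.
Qed.

Lemma cexp_neq0 z : cexp z != 0.
Proof. by rewrite -normc_gt0 normc_cexp expR_gt0. Qed.

Lemma cexpN z : cexp (- z) = (cexp z)^-1.
Proof.
apply: (mulfI (cexp_neq0 z)); rewrite mulfV ?cexp_neq0//.
by rewrite -cexpD subrr cexp0.
Qed.

(** Mean value theorem between 0 and b for either sign of b; a pointwise bound on the derivative
    then bounds the increment. *)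
Lemma MVT_origin (f df : R -> R) b :
  (forall x, is_derive x 1 f (df x)) ->
  exists2 c, `|c| <= `|b| & f b - f 0 = df c * b.
Proof.
move=> fdf.
have cf A : {within A, continuous f}.
  by apply: continuous_subspaceT => x; apply: differentiable_continuous; apply/derivable1_diffP.
have [b0|b0|->] := ltgtP b 0; last by exists 0; rewrite ?subrr ?mulr0// normr0.
- have [c] := MVT b0 (fun x _ => fdf x) (cf _).
  rewrite in_itv/= => /andP[bc c0] H; exists c.
    by rewrite !ltr0_norm// lerN2 ltW.
  by rewrite -opprB H sub0r mulrN opprK.
- have [c] := MVT b0 (fun x _ => fdf x) (cf _).
  rewrite in_itv/= => /andP[c0 cb] H; exists c; last by rewrite H subr0.
  by rewrite !gtr0_norm// ltW.
Qed.

Lemma ler_norm_sin b : `|sin b| <= `|b|.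
Proof.
have [c _] := MVT_origin sin cos b (fun x => is_derive_sin x).
by rewrite sin0 subr0 => ->; rewrite normrM ler_piMl// cos_max.
Qed.

Lemma cos_sub1_le b : `|cos b - 1| <= `|b| ^+ 2 /\ `|cos b - 1| <= `|b|.
Proof.
have [c cb] := MVT_origin cos (fun x => - sin x) b (fun x => is_derive_cos x).
rewrite cos0 => ->; rewrite normrM normrN expr2; split.
  by rewrite ler_wpM2r// (le_trans (ler_norm_sin c)).
by rewrite ler_piMl// sin_max.
Qed.

Lemma sin_sub_le b : `|sin b - b| <= `|b| ^+ 2.
Proof.
have dsin x : is_derive x (1 : R) (fun x => sin x - x) (cos x - 1).
  exact: is_deriveB.
have [c cb] := MVT_origin _ _ b dsin.
rewrite sin0 !subr0 => ->; rewrite normrM expr2.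
by rewrite ler_wpM2r// (le_trans (cos_sub1_le c).2).
Qed.

(** Both signs follow from 1 + a <= exp a and 1 - a <= exp (- a), using exp a * exp (- a) = 1. *)
Lemma expR_sub1_le a : `|expR a - 1| <= `|a| * expR `|a|.
Proof.
have h1 := expR_ge1Dx a; have h2 := expR_ge1Dx (- a).
have e0 := expR_gt0 a; have e1 := expR_gt0 (- a).
have ee : expR a * expR (- a) = 1 by rewrite -expRD subrr expR0.
have [a0|a0] := lerP 0 a.
  by rewrite (ger0_norm a0) ger0_norm; nra.
rewrite (ltr0_norm a0) ler0_norm; nra.
Qed.

Lemma expR_sub1x_le a : `|expR a - 1 - a| <= `|a| ^+ 2 * expR `|a|.
Proof.
have h1 := expR_ge1Dx a; have h2 := expR_ge1Dx (- a).
have e0 := expR_gt0 a; have e1 := expR_gt0 (- a).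
have ee : expR a * expR (- a) = 1 by rewrite -expRD subrr expR0.
rewrite ger0_norm; last by lra.
apply: (@le_trans _ _ (a * (expR a - 1))); first by nra.
apply: le_trans (ler_norm _) _.
by rewrite normrM expr2 -mulrA ler_wpM2l// expR_sub1_le.
Qed.

(** The real and imaginary parts of the remainder split into four terms, each at most |z|^2 exp |z|;
    the constant 5 has slack. *)
Lemma cexp_taylor z :
  normc (cexp z - 1 - z) <= 5 * normc z ^+ 2 * expR (normc z).
Proof.
have ha := ler_Re_normc z; have hb := ler_Im_normc z.
apply: le_trans (ler_normcReIm _) _.
move: (normc z) ha hb => n; case: z => a b /= ha hb.
rewrite !oppr0 addr0.
have n0 : 0 <= n by apply: le_trans ha.
have E1 : 1 <= expR n by rewrite -expR0 ler_expR.
have Ea : expR a <= expR n by rewrite ler_expR (le_trans (ler_norm _)).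
have Eaa : expR `|a| <= expR n by rewrite ler_expR.
have e0 := expR_gt0 a.
have sq x : `|x| <= n -> `|x| ^+ 2 <= n ^+ 2 by move=> xn; rewrite ler_pXn2r// nnegrE.
have A1 : `|expR a - 1 - a| <= n ^+ 2 * expR n.
  apply: le_trans (expR_sub1x_le a) _.
  by rewrite ler_pM// ?sqr_ge0 ?expR_ge0// sq.
have A2 : `|expR a * (cos b - 1)| <= n ^+ 2 * expR n.
  rewrite normrM mulrC ler_pM// ?(ger0_norm (expR_ge0 a))//.
  exact: le_trans (cos_sub1_le b).1 (sq _ hb).
have A3 : `|(expR a - 1) * sin b| <= n ^+ 2 * expR n.
  rewrite normrM expr2 mulrAC ler_pM//; last exact: le_trans (ler_norm_sin b) hb.
  apply: le_trans (expR_sub1_le a) _.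
  by rewrite ler_pM ?expR_ge0.
have A4 : `|sin b - b| <= n ^+ 2 * expR n.
  apply: le_trans (sin_sub_le b) _; apply: le_trans (sq _ hb) _.
  by rewrite ler_peMr// sqr_ge0.
have -> : expR a * cos b - 1 - a = (expR a - 1 - a) + expR a * (cos b - 1) by ring.
have -> : expR a * sin b - b = (expR a - 1) * sin b + (sin b - b) by ring.
have := ler_normD (expR a - 1 - a) (expR a * (cos b - 1)).
have := ler_normD ((expR a - 1) * sin b) (sin b - b).
have : 0 <= n ^+ 2 * expR n by rewrite mulr_ge0 ?sqr_ge0 ?expR_ge0.
rewrite -mulrA; lra.
Qed.

End ComplexBasics.

(** * Square-integrable functions *)

Local Arguments normc : simpl never.

Section Integrals.
Context {R : realType}.
Local Notation mu := (@lebesgue_measure R).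
Local Notation itg u := (mu.-integrable setT (EFin \o u)).
Implicit Types (u v : R -> R) (f g h : R -> R[i]).

Lemma itg_le u v : measurable_fun setT u -> (forall x, `|u x| <= v x) ->
  itg v -> itg u.
Proof.
move=> mu_ uv; apply: le_integrable => //; first exact/measurable_EFinP.
by move=> x _; rewrite /= lee_fin (le_trans (uv x))// ler_norm.
Qed.

Lemma itgD u v : itg u -> itg v -> itg (fun x => u x + v x).
Proof. by move=> iu iv; exact: (integrableD measurableT iu iv). Qed.

Lemma itgB u v : itg u -> itg v -> itg (fun x => u x - v x).
Proof. by move=> iu iv; exact: (integrableB measurableT iu iv). Qed.

Lemma itgZ a u : itg u -> itg (fun x => a * u x).
Proof. by move=> iu; exact: (integrableZl measurableT a iu). Qed.

Lemma integral_Rintegral u : itg u -> (\int[mu]_x (u x)%:E)%E = (\int[mu]_x u x)%:E.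
Proof. by move=> iu; rewrite /Rintegral fineK// integrable_fin_num. Qed.

Lemma ge0_itgP u : measurable_fun setT u -> (forall x, 0 <= u x) ->
  itg u <-> (\int[mu]_x (u x)%:E < +oo)%E.
Proof.
move=> mu_ u0; split=> [/integral_Rintegral ->|ui]; first exact: ltry.
apply/integrableP; split; first exact/measurable_EFinP.
by under eq_integral do rewrite /= ger0_norm//.
Qed.

Definition cmeasurable f :=
  measurable_fun setT (fun x => Re (f x)) /\ measurable_fun setT (fun x => Im (f x)).

Lemma cmeasurableD f g : cmeasurable f -> cmeasurable g ->
  cmeasurable (fun x => f x + g x).
Proof.
move=> [fr fi] [gr gi]; split.
  by under eq_fun do rewrite cReD; exact: measurable_funD.
by under eq_fun do rewrite cImD; exact: measurable_funD.
Qed.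

Lemma cmeasurableM f g : cmeasurable f -> cmeasurable g ->
  cmeasurable (fun x => f x * g x).
Proof.
move=> [fr fi] [gr gi]; split.
  by under eq_fun do rewrite cReM; apply: measurable_funB; exact: measurable_funM.
by under eq_fun do rewrite cImM; apply: measurable_funD; exact: measurable_funM.
Qed.

Lemma cmeasurable_cst (a : R[i]) : cmeasurable (fun=> a).
Proof. by split; exact: measurable_cst. Qed.

Lemma cmeasurableJ f : cmeasurable f -> cmeasurable (fun x => (f x)^*).
Proof.
move=> [fr fi]; split; first by under eq_fun do rewrite cReJ.
by under eq_fun do rewrite cImJ; exact: measurableT_comp.
Qed.

Lemma measurable_sqr_normc f : cmeasurable f ->
  measurable_fun setT (fun x => normc (f x) ^+ 2).
Proof.
move=> [fr fi]; under eq_fun do rewrite sqr_normcE.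
by apply: measurable_funD; exact: measurable_funX.
Qed.

Lemma cintegrable_le f v : cmeasurable f -> (forall x, normc (f x) <= v x) ->
  itg v -> cintegrable f.
Proof.
move=> [fr fi] fv iv; split; apply: itg_le iv => // x;
  apply: le_trans (fv x); [exact: ler_Re_normc|exact: ler_Im_normc].
Qed.

(** The factor 2 comes from estimating real and imaginary parts separately. This bound only serves
    to place images in L2; operator norms are bounded through Cauchy-Schwarz. *)
Lemma normc_cintegral_le f v : cmeasurable f -> (forall x, normc (f x) <= v x) ->
  itg v -> normc (cintegral f) <= 2 * \int[mu]_x v x.
Proof.
move=> mf fv iv; have [ir ii] := cintegrable_le _ _ mf fv iv.
have aux u : itg u -> (forall x, `|u x| <= v x) ->
    `|\int[mu]_x u x| <= \int[mu]_x v x.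
  move=> iu uv; apply: le_trans (le_normr_Rintegral _ iu) _ => //.
  by apply: le_Rintegral => //; exact: integrable_norm.
apply: le_trans (ler_normcReIm _) _.
rewrite mulrDl mul1r lerD//= aux// => x; apply: le_trans (fv x);
  [exact: ler_Re_normc|exact: ler_Im_normc].
Qed.

Lemma eq_cintegral f g : f =1 g -> cintegral f = cintegral g.
Proof. by move=> /funext ->. Qed.

Lemma cintegrableD f g : cintegrable f -> cintegrable g ->
  cintegrable (fun x => f x + g x).
Proof.
move=> [fr fi] [gr gi]; split; rewrite /comp.
  by under eq_fun do rewrite cReD; exact: itgD.
by under eq_fun do rewrite cImD; exact: itgD.
Qed.

Lemma cintegrableZ (a : R[i]) f : cintegrable f -> cintegrable (fun x => a * f x).
Proof.
move=> [fr fi]; split; rewrite /comp.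
  by under eq_fun do rewrite cReM; apply: itgB; exact: itgZ.
by under eq_fun do rewrite cImM; apply: itgD; exact: itgZ.
Qed.

Lemma cintegralD f g : cintegrable f -> cintegrable g ->
  cintegral (fun x => f x + g x) = cintegral f + cintegral g.
Proof.
move=> [fr fi] [gr gi]; apply: complexP; rewrite ?cReD ?cImD /=.
  by under eq_Rintegral do rewrite cReD; rewrite RintegralD.
by under eq_Rintegral do rewrite cImD; rewrite RintegralD.
Qed.

Lemma cintegralZ (a : R[i]) f : cintegrable f ->
  cintegral (fun x => a * f x) = a * cintegral f.
Proof.
move=> [fr fi]; apply: complexP; rewrite ?cReM ?cImM /=.
  under eq_Rintegral do rewrite cReM.
  by rewrite RintegralB ?RintegralZl//; exact: itgZ.
under eq_Rintegral do rewrite cImM.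
by rewrite RintegralD ?RintegralZl//; exact: itgZ.
Qed.

Lemma cintegralJ f : cintegrable f ->
  cintegral (fun x => (f x)^*) = (cintegral f)^*.
Proof.
move=> [fr fi]; apply: complexP; rewrite ?cReJ ?cImJ /=.
  by under eq_Rintegral do rewrite cReJ.
under eq_Rintegral do rewrite cImJ -mulN1r.
by rewrite RintegralZl// mulN1r.
Qed.

Lemma ae_imply (P Q : R -> Prop) : (forall x, P x -> Q x) ->
  {ae mu, forall x, P x} -> {ae mu, forall x, Q x}.
Proof.
move=> PQ.
exact: (@filterS _ (almost_everywhere mu) (ae_filter_ringOfSetsType mu) P Q PQ).
Qed.

Lemma ae_eq_cintegral f g : cintegrable f -> cintegrable g ->
  {ae mu, forall x, f x = g x} -> cintegral f = cintegral g.
Proof.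
move=> [fr fi] [gr gi] fg; rewrite /cintegral /Rintegral.
congr (fine _ +i* fine _); apply: ae_eq_integral => //;
  try exact: (measurable_int mu); by apply: ae_imply fg => x /= -> _.
Qed.

End Integrals.

(** * Inner product, Bessel's inequality and orthonormal bases *)

Section SquareIntegrable.
Context {R : realType}.
Local Notation mu := (@lebesgue_measure R).
Local Notation itg u := (mu.-integrable setT (EFin \o u)).
Implicit Types (f g h : R -> R[i]).

(** A real number, hence 0 by default when the integral is infinite; it is linked to [L2norm] only
    for functions in L2. *)
Definition sqnorm f : R := \int[mu]_x (normc (f x) ^+ 2).

Lemma sqnorm_ge0 f : 0 <= sqnorm f.
Proof. by apply: Rintegral_ge0 => x _; exact: sqr_ge0. Qed.

Lemma L2norm_sqrte f :
  L2norm f = sqrte (\int[mu]_x (normc (f x) ^+ 2)%:E)%E.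
Proof.
rewrite /L2norm unlock poweR12_sqrt; last first.
  by apply: integral_ge0 => x _; exact: poweR_ge0.
congr sqrte; apply: eq_integral => x _ /=.
by rewrite ger0_norm ?normc_ge0// powR_mulrn ?normc_ge0.
Qed.

Lemma L2P f : L2 f <-> cmeasurable f /\ itg (fun x => normc (f x) ^+ 2).
Proof.
have E : cmeasurable f -> (L2norm f < +oo)%E <-> itg (fun x => normc (f x) ^+ 2).
  move=> mf; rewrite (ge0_itgP _ (measurable_sqr_normc _ mf)); last first.
    by move=> x; exact: sqr_ge0.
  have i0 : (0 <= \int[mu]_x (normc (f x) ^+ 2)%:E)%E.
    by apply: integral_ge0 => x _; rewrite lee_fin sqr_ge0.
  by rewrite L2norm_sqrte -!ge0_fin_numE ?sqrte_ge0// sqrte_fin_num.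
split=> [[fr fi fy]|[[fr fi] fy]]; first by split=> //; apply/E.
by split=> //; apply/E.
Qed.

Lemma L2norm_sqnorm f : L2 f -> L2norm f = (Num.sqrt (sqnorm f))%:E.
Proof. by move=> /L2P[_ fi]; rewrite L2norm_sqrte integral_Rintegral. Qed.

Lemma sqr_L2norm f : L2 f -> (L2norm f ^+ 2 = (sqnorm f)%:E)%E.
Proof.
by move=> /L2norm_sqnorm ->; rewrite -EFin_expe sqr_sqrtr ?sqnorm_ge0.
Qed.

Lemma L2norm_le1 f : L2 f -> (L2norm f <= 1)%E -> sqnorm f <= 1.
Proof.
by move=> /L2norm_sqnorm ->; rewrite lee_fin -[X in _ <= X -> _]sqrtr1 ler_sqrt.
Qed.

Lemma L2_le f v : cmeasurable f -> (forall x, normc (f x) ^+ 2 <= v x) ->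
  itg v -> L2 f.
Proof.
move=> mf fv iv; apply/L2P; split => //; apply: itg_le iv.
  exact: measurable_sqr_normc.
by move=> x; rewrite ger0_norm ?sqr_ge0.
Qed.

Lemma L2D f g : L2 f -> L2 g -> L2 (fun x => f x + g x).
Proof.
move=> /L2P[mf fi] /L2P[mg gi].
apply: L2_le (cmeasurableD _ _ mf mg) _ (itgZ 2 _ (itgD _ _ fi gi)) => x.
have := le_normcD (f x) (g x); have := normc_ge0 (f x + g x).
have := normc_ge0 (f x); have := normc_ge0 (g x).
move: (normc _) (normc _) (normc _) => a b c a0 b0 c0 cab.
apply: (@le_trans _ _ ((b + c) ^+ 2)); first by rewrite ler_pXn2r// nnegrE addr_ge0.
by have := sqr_ge0 (b - c); nra.
Qed.

Lemma L2Z (a : R[i]) f : L2 f -> L2 (fun x => a * f x).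
Proof.
move=> /L2P[mf fi].
apply: L2_le (cmeasurableM _ _ (cmeasurable_cst a) mf) _ (itgZ (normc a ^+ 2) _ fi) => x.
by rewrite normcM exprMn.
Qed.

Lemma L2J f : L2 f -> L2 (fun x => (f x)^*).
Proof.
move=> /L2P[mf fi]; apply: L2_le (cmeasurableJ _ mf) _ fi => x.
by rewrite normcJE.
Qed.

Lemma L2_0 : L2 (fun=> 0 : R[i]).
Proof.
apply: (L2_le _ (fun=> 0)); first exact: cmeasurable_cst.
  by move=> x; rewrite normc0 expr0n.
exact: integrable0.
Qed.

Lemma L2M_cintegrable f g : L2 f -> L2 g -> cintegrable (fun x => f x * g x).
Proof.
move=> /L2P[mf fi] /L2P[mg gi].
apply: cintegrable_le (cmeasurableM _ _ mf mg) _ (itgD _ _ fi gi) => x.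
rewrite normcM; have := normc_ge0 (f x); have := normc_ge0 (g x).
by move: (normc _) (normc _) => a b; have := sqr_ge0 (b - a); nra.
Qed.

Lemma L2dotJ f g : L2 f -> L2 g -> L2dot g f = (L2dot f g)^*.
Proof.
move=> Lf Lg; rewrite /L2dot -cintegralJ; last exact/L2M_cintegrable/L2J.
by apply: eq_cintegral => x; rewrite rmorphM /= conjcK mulrC.
Qed.

Lemma L2dotZl a f g : L2 f -> L2 g -> L2dot (fun x => a * f x) g = a * L2dot f g.
Proof.
move=> Lf Lg; rewrite /L2dot -cintegralZ; last exact/L2M_cintegrable/L2J.
by apply: eq_cintegral => x; rewrite mulrA.
Qed.

Lemma L2dotDl f g h : L2 f -> L2 g -> L2 h ->
  L2dot (fun x => f x + g x) h = L2dot f h + L2dot g h.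
Proof.
move=> Lf Lg Lh.
rewrite /L2dot -cintegralD; do ?exact/L2M_cintegrable/L2J.
by apply: eq_cintegral => x; rewrite mulrDl.
Qed.

Lemma sqnormZ a f : L2 f -> sqnorm (fun x => a * f x) = normc a ^+ 2 * sqnorm f.
Proof.
move=> /L2P[_ fi]; rewrite /sqnorm -RintegralZl//.
by apply: eq_Rintegral => x _; rewrite normcM exprMn.
Qed.

Lemma L2dot_self f : L2dot f f = (sqnorm f)%:C.
Proof.
apply: complexP; rewrite /= /sqnorm.
  by apply: eq_Rintegral => x _; rewrite sqr_normcE cReM cReJ cImJ; ring.
under eq_Rintegral do rewrite cImM cReJ cImJ mulrN addrC mulrC subrr.
by rewrite Rintegral_cst// mul0r.
Qed.

(** Expansion of |h - l f|^2 with l the inner product of h and f. Keeping [sqnorm f] general covers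
    both uses: norm at most 1 for Cauchy-Schwarz, norm 1 for Bessel. *)
Lemma sqnorm_sub_proj h f : L2 h -> L2 f ->
  sqnorm (fun x => h x - L2dot h f * f x) =
  sqnorm h - (2 - sqnorm f) * normc (L2dot h f) ^+ 2.
Proof.
move=> Lh Lf; set l := L2dot h f.
have [/L2P[_ hi] /L2P[_ fi]] := (Lh, Lf).
have ci : cintegrable (fun x => l^* * (h x * (f x)^*)).
  exact/cintegrableZ/L2M_cintegrable/L2J.
have lE : \int[mu]_x Re (l^* * (h x * (f x)^*)) = normc l ^+ 2.
  rewrite -[LHS]/(Re (cintegral (fun x => l^* * (h x * (f x)^*)))).
  rewrite cintegralZ; last exact/L2M_cintegrable/L2J.
  by rewrite -[cintegral _]/l sqr_normcE cReM cReJ cImJ; ring.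
have E x : normc (h x - l * f x) ^+ 2 =
    (normc (h x) ^+ 2 + normc l ^+ 2 * normc (f x) ^+ 2) -
    2 * Re (l^* * (h x * (f x)^*)).
  by rewrite !sqr_normcE !cReImE; ring.
rewrite /sqnorm; under eq_Rintegral do rewrite E.
rewrite RintegralB//; [|by apply: itgD => //; exact: itgZ|exact: (itgZ 2 _ ci.1)].
rewrite RintegralD//; last exact: itgZ.
rewrite RintegralZl// RintegralZl//; last exact: ci.1.
by rewrite lE; ring.
Qed.

(** Cauchy-Schwarz on the unit ball: the residual has nonnegative square norm and [2 - sqnorm f] is
    at least 1. *)
Lemma sqr_L2dot_le h f : L2 h -> L2 f -> sqnorm f <= 1 ->
  normc (L2dot h f) ^+ 2 <= sqnorm h.
Proof.
move=> Lh Lf f1; have := sqnorm_ge0 (fun x => h x - L2dot h f * f x).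
rewrite sqnorm_sub_proj//; have := sqr_ge0 (normc (L2dot h f)); nra.
Qed.

(** Induction on the family: h is replaced by its residual after projection on the first vector, and
    orthogonality leaves the remaining coefficients unchanged. *)
Lemma bessel h (s : seq (R -> R[i])) : uniq s -> L2 h ->
  (forall e, e \in s -> L2 e /\ L2dot e e = 1) ->
  (forall e e', e \in s -> e' \in s -> e != e' -> L2dot e e' = 0) ->
  \sum_(e <- s) normc (L2dot h e) ^+ 2 <= sqnorm h.
Proof.
elim: s h => [|e s IH] h /=; first by rewrite big_nil sqnorm_ge0.
move=> /andP[es us] Lh Hn Ho; rewrite big_cons.
have [Le e1] := Hn e (mem_head _ _).
have Lp : L2 (fun x => - L2dot h e * e x) by exact: L2Z.
set h' := fun x => h x - L2dot h e * e x.
have h'E : h' = fun x => h x + - L2dot h e * e x.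
  by apply/funext => x; rewrite /h' mulNr.
have Lh' : L2 h' by rewrite h'E; exact: L2D.
have n1 : sqnorm e = 1 by move: e1; rewrite L2dot_self => -[].
have : \sum_(e' <- s) normc (L2dot h' e') ^+ 2 <= sqnorm h'.
  apply: IH => // [x xs|x y xs ys]; first by apply: Hn; rewrite inE xs orbT.
  by apply: Ho; rewrite inE ?xs ?ys orbT.
rewrite [sqnorm h']sqnorm_sub_proj// n1.
rewrite (_ : 2 - 1 = 1 :> R) ?mul1r; last by ring.
rewrite lerBrDl; apply: le_trans.
rewrite lerD2l le_eqVlt; apply/orP; left; apply/eqP.
apply: eq_big_seq => e' e's.
have Le' : L2 e' by case: (Hn e'); rewrite ?inE ?e's ?orbT.
congr (normc _ ^+ 2); rewrite h'E L2dotDl// L2dotZl//.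
rewrite [L2dot e e']Ho ?mulr0 ?addr0 ?inE ?eqxx ?e's ?orbT//.
by apply: contraNneq es => ->.
Qed.

Lemma sqnorm0_ae f : L2 f -> sqnorm f = 0 -> {ae mu, forall x, f x = 0}.
Proof.
move=> /L2P[mf fi] f0.
have mn : measurable_fun setT (EFin \o (fun x => normc (f x) ^+ 2)).
  by apply/measurable_EFinP; exact: measurable_sqr_normc.
have i0 : (\int[mu]_x `|(EFin \o (fun x : R => (normc (f x) ^+ 2)%R)) x| = 0)%E.
  under eq_integral do rewrite /= ger0_norm ?sqr_ge0//.
  by rewrite integral_Rintegral// -/(sqnorm f) f0.
have := (ae_eq_integral_abs mu measurableT mn).1 i0.
apply: ae_imply => x /= /(_ I) [] /eqP.
by rewrite expf_eq0/= normc_eq0 => /eqP.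
Qed.

(** Zorn's lemma for inclusion: if f is orthogonal to a maximal set and has nonzero norm, its
    normalisation could be adjoined. This supplies the basis over which the Hilbert-Schmidt sum is
    taken. *)
Lemma orthonormal_basis_exists : exists B : set (R -> R[i]), orthonormal_basis B.
Proof.
have [F FO Ftot|B [BO Bmax]] := Zorn_bigcup (T := R -> R[i]) (P := @Defs.orthonormal R).
  split=> [e [X FX Xe]|e e' [X FX Xe] [Y FY Ye'] ee']; first exact: (FO _ FX).1.
  have [XY|YX] := Ftot _ _ FX FY; first by apply: (FO _ FY).2 => //; exact: XY.
  by apply: (FO _ FX).2 => //; exact: YX.
exists B; split=> // f Lf fB; apply: sqnorm0_ae => //.
apply: contrapT => /eqP f0.
have fp : 0 < sqnorm f by rewrite lt_def f0 sqnorm_ge0.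
pose a := ((Num.sqrt (sqnorm f))^-1)%:C : R[i]; pose g := fun x => a * f x.
have Lg : L2 g by exact: L2Z.
have g1 : L2dot g g = 1.
  rewrite L2dot_self sqnormZ// normcR ger0_norm ?invr_ge0 ?sqrtr_ge0//.
  by rewrite exprVn sqr_sqrtr ?mulVf// ltW.
have gB e : B e -> L2dot g e = 0.
  by move=> Be; rewrite L2dotZl ?fB ?mulr0//; exact: (BO.1 _ Be).1.
have nBg : ~ B g by move=> /gB; rewrite g1 => /eqP; rewrite oner_eq0.
apply: (Bmax (g |` B)).
  by split=> [e Be|]; [right|move=> /(_ g (or_introl erefl))].
split=> [e [->|/BO.1]//|e e' [->|Be] [->|Be']// ee'].
- exact: gB.
- rewrite L2dotJ// ?gB ?rmorph0//; exact: (BO.1 _ Be).1.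
- exact: BO.2.
Qed.

End SquareIntegrable.

(** * Operators with Gaussian-bounded kernels *)

Section GaussianKernels.
Context {R : realType}.
Local Notation mu := (@lebesgue_measure R).
Local Notation itg u := (mu.-integrable setT (EFin \o u)).
Implicit Types (f g : R -> R[i]) (k : R -> R -> R[i]) (x y d M : R).

Definition gauss d x : R := expR (- (d * x ^+ 2)).

Lemma gauss_gt0 d x : 0 < gauss d x.
Proof. exact: expR_gt0. Qed.

Lemma gauss_le1 d x : 0 <= d -> gauss d x <= 1.
Proof. by move=> d0; rewrite -expR0 ler_expR oppr_le0 mulr_ge0 ?sqr_ge0. Qed.

Lemma sqr_gauss d x : gauss d x ^+ 2 = gauss (2 * d) x.
Proof. by rewrite /gauss -expRM_natl; congr expR; ring. Qed.

Lemma gaussM d x y : gauss d x * gauss d y = expR (- (d * (x ^+ 2 + y ^+ 2))).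
Proof. by rewrite /gauss -expRD; congr expR; ring. Qed.

Lemma itg_gauss d : 0 < d -> itg (gauss d).
Proof.
(* The standard deviation with 1 / (2 s^2) = d, so that [gauss d] is a normal density up to its peak
   value. *)
move=> d0; pose s := Num.sqrt ((2 * d)^-1).
have s0 : 0 < s by rewrite sqrtr_gt0 invr_gt0 mulr_gt0.
have p0 := normal_peak_gt0 (lt0r_neq0 s0).
have -> : gauss d = fun x => (normal_peak s)^-1 * normal_pdf 0 s x.
  apply/funext => x; rewrite /normal_pdf gt_eqF//= mulrA mulVf ?gt_eqF// mul1r.
  rewrite /gauss /normal_fun; congr expR; rewrite sqr_sqrtr ?invr_ge0 ?mulr_ge0 ?ltW//.
  by rewrite subr0 mulNr; field; rewrite gt_eqF.
by apply: itgZ; exact: integrable_normal_pdf.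
Qed.

Definition ccontinuous f :=
  continuous (fun x => Re (f x)) /\ continuous (fun x => Im (f x)).

Lemma ccontinuous_cst (a : R[i]) : ccontinuous (fun=> a).
Proof. by split=> x; exact: cst_continuous. Qed.

Lemma ccontinuousD f g : ccontinuous f -> ccontinuous g ->
  ccontinuous (fun x => f x + g x).
Proof.
move=> [fr fi] [gr gi]; split.
  by under eq_fun do rewrite cReD; move=> x; apply: cvgD; [exact: fr|exact: gr].
by under eq_fun do rewrite cImD; move=> x; apply: cvgD; [exact: fi|exact: gi].
Qed.

Lemma ccontinuousM f g : ccontinuous f -> ccontinuous g ->
  ccontinuous (fun x => f x * g x).
Proof.
move=> [fr fi] [gr gi]; split.
  under eq_fun do rewrite cReM.
  move=> x; apply: cvgB; apply: cvgM; [exact: fr|exact: gr|exact: fi|exact: gi].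
under eq_fun do rewrite cImM.
move=> x; apply: cvgD; apply: cvgM; [exact: fr|exact: gi|exact: fi|exact: gr].
Qed.

Lemma ccontinuous_real (u : R -> R) : continuous u -> ccontinuous (fun x => (u x)%:C).
Proof. by move=> cu; split=> // x; exact: cst_continuous. Qed.

Lemma ccontinuous_cexp f : ccontinuous f -> ccontinuous (fun x => cexp (f x)).
Proof.
move=> [fr fi]; split=> x.
  apply: cvgM; first by apply: continuous_comp (fr x) _; exact: continuous_expR.
  by apply: continuous_comp (fi x) _; exact: continuous_cos.
apply: cvgM; first by apply: continuous_comp (fr x) _; exact: continuous_expR.
by apply: continuous_comp (fi x) _; exact: continuous_sin.
Qed.

Lemma ccontinuous_measurable f : ccontinuous f -> cmeasurable f.
Proof. by move=> [fr fi]; split; exact: continuous_measurable_fun. Qed.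

Definition gauss_bounded M d k := forall x y, normc (k x y) <= M * (gauss d x * gauss d y).

(** Continuity in the second variable makes rows measurable; continuity in the first makes images
    continuous. *)
Definition separately_continuous k :=
  (forall x, ccontinuous (k x)) /\ (forall y, ccontinuous (k ^~ y)).

Lemma gauss_bounded_ge0 M d k : gauss_bounded M d k -> 0 <= M.
Proof.
move=> /(_ 0 0) /(le_trans (normc_ge0 _)).
by rewrite pmulr_lge0// mulr_gt0// gauss_gt0.
Qed.

Lemma itg_sum (I : eqType) (s : seq I) (F : I -> R -> R) :
  (forall e, e \in s -> itg (F e)) ->
  itg (fun x => \sum_(e <- s) F e x) /\
  \int[mu]_x (\sum_(e <- s) F e x) = \sum_(e <- s) \int[mu]_x F e x.
Proof.
elim: s => [|e s IH] iF.
  split; rewrite /comp; first by under eq_fun do rewrite big_nil; exact: integrable0.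
  by under eq_Rintegral do rewrite big_nil; rewrite big_nil Rintegral_cst// mul0r.
have [|iS ES] := IH; first by move=> x xs; apply: iF; rewrite inE xs orbT.
have ie : itg (F e) by apply: iF; rewrite mem_head.
have E : (fun x => \sum_(e <- e :: s) F e x) = fun x => F e x + \sum_(e <- s) F e x.
  by apply/funext => x; rewrite big_cons.
by rewrite E big_cons -ES; split; [exact: itgD|rewrite RintegralD].
Qed.

Section Kernel.
Variables (k : R -> R -> R[i]) (M d : R).
Hypotheses (d0 : 0 < d) (ck : separately_continuous k) (bk : gauss_bounded M d k).

Let M0 : 0 <= M := gauss_bounded_ge0 _ _ _ bk.
Let G : R := \int[mu]_x gauss (2 * d) x.
Let ig : itg (gauss (2 * d)).
Proof. by apply: itg_gauss; rewrite mulr_gt0. Qed.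

Lemma gauss_kernel_row x :
  L2 (k x) /\ sqnorm (k x) <= (M ^+ 2 * G) * gauss (2 * d) x.
Proof.
have mk := ccontinuous_measurable _ (ck.1 x).
have bx y : normc (k x y) ^+ 2 <= (M ^+ 2 * gauss (2 * d) x) * gauss (2 * d) y.
  rewrite -!sqr_gauss -mulrA -exprMn -exprMn ler_pXn2r ?nnegrE ?normc_ge0//.
  by rewrite !mulr_ge0// ltW// gauss_gt0.
have ib := itgZ (M ^+ 2 * gauss (2 * d) x) _ ig.
have Lk : L2 (k x) by exact: L2_le ib.
split=> //; rewrite [leRHS](_ : _ = (M ^+ 2 * gauss (2 * d) x) * G); last by ring.
rewrite -RintegralZl//; apply: le_Rintegral => //; first by case/L2P: Lk.
Qed.

(** From gauss d y |f y| <= gauss (2d) y + |f y|^2: an integrable majorant in y, uniform in x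
    because [gauss d x] is at most 1. *)
Let dominant f y := M * (gauss (2 * d) y + normc (f y) ^+ 2).

Let itg_dominant f : L2 f -> itg (dominant f).
Proof. by move=> /L2P[_ fi]; apply: itgZ; exact: itgD. Qed.

Let kernel_dominated f x y :
  normc (k x y * f y) <= gauss d x * dominant f y.
Proof.
rewrite normcM; apply: (@le_trans _ _ (M * (gauss d x * gauss d y) * normc (f y))).
  by rewrite ler_wpM2r ?normc_ge0.
rewrite /dominant -sqr_gauss; have gx := gauss_gt0 d x.
have -> : M * (gauss d x * gauss d y) * normc (f y) =
  (gauss d x * M) * (gauss d y * normc (f y)) by ring.
rewrite [leRHS]mulrA ler_wpM2l ?mulr_ge0 ?(ltW gx)//.
have := normc_ge0 (f y); have := gauss_gt0 d y.
by move: (normc _) (gauss _ _) => a b; have := sqr_ge0 (b - a); nra.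
Qed.

Lemma gauss_kernel_defined : integral_operator_defined k.
Proof. by move=> f Lf x; apply: L2M_cintegrable => //; exact: (gauss_kernel_row x).1. Qed.

(** Dominated convergence with the x-independent majorant [dominant f]; its purpose is the
    measurability of the image. *)
Lemma gauss_kernel_continuous f : L2 f -> ccontinuous (integral_operator k f).
Proof.
move=> Lf.
have dom x y : normc (k x y * f y) <= dominant f y.
  apply: le_trans (kernel_dominated f x y) _; rewrite ler_piMl//.
    by rewrite /dominant mulr_ge0// addr_ge0 ?sqr_ge0// ltW// gauss_gt0.
  exact: gauss_le1 (ltW d0).
have ckf y : ccontinuous (fun x => k x y * f y).
  by apply: ccontinuousM; [exact: ck.2|exact: ccontinuous_cst].
split=> x.
  have xI : x \in (`]x - 1, x + 1[%classic : set R).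
    by rewrite inE /= in_itv/=; apply/andP; split; lra.
  apply: (@continuity_under_integral _ _ _ mu (fun x y => Re (k x y * f y)) setT
    measurableT (x - 1) (x + 1) _ _ (dominant f)) xI => //.
  - by move=> z _; exact: (gauss_kernel_defined f Lf z).1.
  - by apply: aeW => y _ z _; exact: (ckf y).1.
  - exact: itg_dominant.
  - by move=> z _; apply: aeW => y _; exact: le_trans (ler_Re_normc _) (dom z y).
have xI : x \in (`]x - 1, x + 1[%classic : set R).
  by rewrite inE /= in_itv/=; apply/andP; split; lra.
apply: (@continuity_under_integral _ _ _ mu (fun x y => Im (k x y * f y)) setT
  measurableT (x - 1) (x + 1) _ _ (dominant f)) xI => //.
- by move=> z _; exact: (gauss_kernel_defined f Lf z).2.
- by apply: aeW => y _ z _; exact: (ckf y).2.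
- exact: itg_dominant.
- by move=> z _; apply: aeW => y _; exact: le_trans (ler_Im_normc _) (dom z y).
Qed.

Lemma gauss_kernel_L2 f : L2 f -> L2 (integral_operator k f).
Proof.
move=> Lf; pose C := 2 * \int[mu]_y dominant f y.
have bT x : normc (integral_operator k f x) <= gauss d x * C.
  have mkf : cmeasurable (fun y => k x y * f y).
    apply: cmeasurableM; last by case/L2P: Lf.
    by apply: ccontinuous_measurable; exact: ck.1.
  have E : \int[mu]_y (gauss d x * dominant f y) = gauss d x * \int[mu]_y dominant f y.
    by apply: RintegralZl => //; exact: itg_dominant.
  rewrite /C mulrCA -E; apply: (normc_cintegral_le _ _ mkf (kernel_dominated f x)).
  by apply: itgZ; exact: itg_dominant.
apply: (L2_le _ (fun x => C ^+ 2 * gauss (2 * d) x)); last exact: itgZ.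
  exact/ccontinuous_measurable/gauss_kernel_continuous.
move=> x; rewrite -sqr_gauss -exprMn mulrC ler_pXn2r ?nnegrE ?normc_ge0//.
exact: le_trans (normc_ge0 _) (bT x).
Qed.

(** Up to conjugation the image at x is the inner product of the conjugated row with f, so
    Cauchy-Schwarz and Bessel can be applied for each x. *)
Lemma normc_integral_operator f x : L2 f ->
  normc (integral_operator k f x) = normc (L2dot (fun y => (k x y)^*) f).
Proof.
move=> Lf; have Lk := (gauss_kernel_row x).1.
rewrite -[LHS]normcJE -cintegralJ; last exact: gauss_kernel_defined.
by congr normc; apply: eq_cintegral => y; rewrite rmorphM.
Qed.

Lemma sqnormJ f : sqnorm (fun x => (f x)^*) = sqnorm f.
Proof. by apply: eq_Rintegral => x _; rewrite normcJE. Qed.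

(** Cauchy-Schwarz bounds the image at x by the norm of the row at x; the squared row norms
    integrate to at most (M G)^2. *)
Lemma gauss_kernel_opnorm : (opnorm (integral_operator k) <= (M * G)%:E)%E.
Proof.
apply: ge_ereal_sup => _ [f [Lf f1] <-].
have LT := gauss_kernel_L2 f Lf; have [_ iT] := (L2P _).1 LT.
have G0 : 0 <= G by apply: Rintegral_ge0 => x _; exact/ltW/gauss_gt0.
rewrite L2norm_sqnorm// lee_fin -[leRHS]ger0_norm ?mulr_ge0// -sqrtr_sqr ler_wsqrtr//.
apply: (@le_trans _ _ (\int[mu]_x ((M ^+ 2 * G) * gauss (2 * d) x))).
  apply: le_Rintegral => // [|x _]; first exact: itgZ.
  rewrite normc_integral_operator//.
  apply: le_trans (sqr_L2dot_le _ _ _ Lf (L2norm_le1 _ Lf f1)) _.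
    exact/L2J/(gauss_kernel_row x).1.
  by rewrite sqnormJ; exact: (gauss_kernel_row x).2.
by rewrite RintegralZl// -/G; lra.
Qed.

Lemma gauss_kernel_bounded : bounded_operator (integral_operator k).
Proof.
have def := gauss_kernel_defined.
split; first exact: gauss_kernel_L2.
- move=> f g Lf Lg fg; apply: aeW => x; apply: ae_eq_cintegral; do ?exact: def.
  by apply: ae_imply fg => y ->.
- move=> a f g Lf Lg; apply: aeW => x; rewrite /integral_operator.
  rewrite -cintegralZ; last exact: def.
  rewrite -cintegralD; [|by apply: cintegrableZ; exact: def|exact: def].
  by apply: eq_cintegral => y; ring.
- exact: le_lt_trans gauss_kernel_opnorm (ltry _).
Qed.

(** For finitely many basis vectors, sum and integral are exchanged and Bessel's inequality for each
    row bounds the integrand by the squared row norm. The resulting bound does not depend on the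
    finite set. *)
Lemma gauss_kernel_hilbert_schmidt : hilbert_schmidt (integral_operator k).
Proof.
split; first exact: gauss_kernel_bounded.
have [B BO] := @orthonormal_basis_exists R; exists B => //.
apply: (@le_lt_trans _ _ (M ^+ 2 * G * G)%:E); last exact: ltry.
apply: ge_ereal_sup => _ [X [finX XB] <-].
rewrite fsbig_finite//=; set s := finmap.enum_fset (fset_set X).
have sB e : e \in s -> B e.
  by move=> es; apply/XB/set_mem; rewrite -(in_fset_set finX).
have sL e : e \in s -> L2 e by move=> /sB /BO.1.1[].
have sT e : e \in s -> L2 (integral_operator k e).
  by move=> /sL; exact: gauss_kernel_L2.
rewrite big_seq (eq_bigr (fun e => (sqnorm (integral_operator k e))%:E)); last first.
  by move=> e /sT; exact: sqr_L2norm.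
rewrite -big_seq sumEFin lee_fin.
have iT e : e \in s -> itg (fun x => normc (integral_operator k e x) ^+ 2).
  by move=> /sT/L2P[].
have [iS <-] := itg_sum _ s _ iT.
rewrite -[leRHS]RintegralZl//; apply: le_Rintegral => // [|x _]; first exact: itgZ.
have Lk : L2 (fun y => (k x y)^*) by exact/L2J/(gauss_kernel_row x).1.
apply: le_trans (gauss_kernel_row x).2; rewrite -sqnormJ.
apply: le_trans (bessel _ s _ Lk _ _); first last.
- move=> e e' es e's ee'; apply: BO.1.2; [exact: sB|exact: sB|exact/eqP].
- by move=> e /sB; exact: BO.1.1.
- exact: finmap.fset_uniq.
rewrite big_seq [leRHS]big_seq; apply: ler_sum => e /sL Le.
by rewrite normc_integral_operator.
Qed.

End Kernel.

Lemma opnorm_ge0 (T : (R -> R[i]) -> (R -> R[i])) : (0 <= opnorm T)%E.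
Proof.
apply: (@le_trans _ _ (L2norm (T (fun=> 0)))); first exact: Lnorm_ge0.
apply: ereal_sup_ubound; exists (fun=> 0) => //; split; first exact: L2_0.
rewrite L2norm_sqnorm; last exact: L2_0.
rewrite /sqnorm normc0 expr0n Rintegral_cst// mul0r sqrtr0.
by rewrite lee_fin ler01.
Qed.

(** Agreement is asked on L2 only, since additivity in the kernel holds where the integrals
    converge. *)
Lemma eq_opnorm (T T' : (R -> R[i]) -> (R -> R[i])) :
  (forall f, L2 f -> T f =1 T' f) -> opnorm T = opnorm T'.
Proof.
move=> TT'; congr ereal_sup; apply/seteqP.
by split=> _ [f [Lf f1] <-]; exists f => //; congr L2norm; apply/funext => x; rewrite TT'.
Qed.

End GaussianKernels.

(** * Families of Gaussian kernels *)

Section Differentiability.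

(** In dimension one differentiability is convergence of the difference quotient. Multiplied by |w -
    z|, the estimate also holds at w = z, so the punctured neighbourhood becomes a full one. *)
Lemma differentiable_distP (K : numFieldType) (f : K^o -> K^o) (z : K^o) :
  differentiable f z <-> exists l : K, forall e : K, 0 < e ->
    \forall w \near z, `|f w - f z - l * (w - z)| <= e * `|w - z|.
Proof.
rewrite -derivable1_diffP /derivable; split.
  move=> /cvg_ex[/= l /cvgrPdist_le fl]; exists l => e e0.
  have /nbhs_ballP[d /= d0 H] := fl _ e0.
  apply/nbhs_ballP; exists d => //= w zw.
  have [->|wz] := eqVneq w z; first by rewrite !subrr mulr0 subrr normr0 mulr0.
  have wz0 : w - z != 0 by rewrite subr_eq0.
  have : `|l - (w - z)^-1 *: (f ((w - z)%:A + z) - f z)| <= e.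
    apply: H => //; move: zw; rewrite -!ball_normE /=.
    by rewrite sub0r normrN distrC.
  rewrite /GRing.scale /= mulr1 subrK => He.
  rewrite distrC (_ : _ - _ = (l - (w - z)^-1 * (f w - f z)) * (w - z)).
    by rewrite normrM ler_wpM2r.
  by rewrite mulrBl mulrAC mulVf// mul1r.
case=> l H; apply/cvg_ex; exists l; apply/cvgrPdist_le => /= e e0.
have /nbhs_ballP[d /= d0 Hd] := H _ e0.
apply/nbhs_ballP; exists d => //= h h0d h0.
have : ball z d (h + z).
  by move: h0d; rewrite -!ball_normE /= sub0r opprD addrCA subrr addr0.
move=> /Hd; rewrite addrK => He; rewrite /GRing.scale /= mulr1.
rewrite -(ler_pM2r (x := `|h|)) ?normr_gt0// -normrM mulrBl mulrAC mulVf// mul1r.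
by rewrite distrC.
Qed.

Context {R : realType}.
Implicit Types (f g : R[i] -> R[i]) (z l : R[i]).

(** The differential is linear over the field [R[i]] itself, so this is complex and not merely real
    differentiability. *)
Definition cdiff f z := differentiable (f : R[i]^o -> R[i]^o) (z : R[i]^o).

Lemma cdiffP f z : cdiff f z <-> exists l : R[i], forall e : R, 0 < e ->
  \forall w \near (z : R[i]^o), normc (f w - f z - l * (w - z)) <= e * normc (w - z).
Proof.
have nE (x : R[i]) : `|x| = (normc x)%:C by case: x.
rewrite /cdiff differentiable_distP; split=> -[l H]; exists l => e e0.
  have := H e%:C; rewrite ltcR => /(_ e0); apply: filterS => w.
  by rewrite !nE -rmorphM lecR.
have eE : e = (Re e)%:C by rewrite RRe_real// gtr0_real.
have := H (Re e); rewrite -ltcR -eE => /(_ e0); apply: filterS => w.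
by rewrite eE !nE -rmorphM lecR.
Qed.

End Differentiability.

(** * Difference quotients of Gaussian kernels *)

Section GaussianFamily.
Context {R : realType}.
Implicit Types (k : R -> R -> R[i]).

Lemma separately_continuousD k k' : separately_continuous k ->
  separately_continuous k' -> separately_continuous (fun x y => k x y + k' x y).
Proof. by move=> [? ?] [? ?]; split=> ?; exact: ccontinuousD. Qed.

Lemma separately_continuousM k k' : separately_continuous k ->
  separately_continuous k' -> separately_continuous (fun x y => k x y * k' x y).
Proof. by move=> [? ?] [? ?]; split=> ?; exact: ccontinuousM. Qed.

Lemma separately_continuous_cst (a : R[i]) : separately_continuous (fun _ _ => a).
Proof. by split=> ?; exact: ccontinuous_cst. Qed.

Definition quadform (a b : R[i]) (x y : R) : R[i] :=
  a * (x * y)%:C - b * (x ^+ 2 + y ^+ 2)%:C.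

Lemma separately_continuous_quadform (a b : R[i]) :
  separately_continuous (quadform a b).
Proof.
have cM (u : R) : continuous (fun x : R => u * x) by move=> x; exact: mulrl_continuous.
have cMr (u : R) : continuous (fun x : R => x * u) by move=> x; exact: mulrr_continuous.
have cS (u : R) : continuous (fun x : R => u + x ^+ 2).
  by move=> x; apply: cvgD; [exact: cst_continuous|exact: exprn_continuous].
have cSr (u : R) : continuous (fun x : R => x ^+ 2 + u).
  by move=> x; apply: cvgD; [exact: exprn_continuous|exact: cst_continuous].
rewrite (_ : quadform a b = fun x y => a * (x * y)%:C + (- b) * (x ^+ 2 + y ^+ 2)%:C).
  by split=> u; apply: ccontinuousD; apply: ccontinuousM;
    do ?[exact: ccontinuous_cst | apply: ccontinuous_real].
by apply/funext => x; apply/funext => y; rewrite mulNr.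
Qed.

Lemma separately_continuous_cexp k : separately_continuous k ->
  separately_continuous (fun x y => cexp (k x y)).
Proof. by move=> [? ?]; split=> ?; exact: ccontinuous_cexp. Qed.

Lemma normc_quadform_le (a b : R[i]) (m x y : R) : normc a <= m -> normc b <= m ->
  normc (quadform a b x y) <= 2 * m * (x ^+ 2 + y ^+ 2).
Proof.
move=> am bm; apply: le_trans (le_normcD _ _) _.
rewrite normcN !normcM !normcR.
have r0 : 0 <= x ^+ 2 + y ^+ 2 by rewrite addr_ge0 ?sqr_ge0.
have xyr : `|x * y| <= x ^+ 2 + y ^+ 2.
  by rewrite ler_norml; apply/andP; split; nra.
rewrite (ger0_norm r0) (_ : 2 * m * _ = m * (x ^+ 2 + y ^+ 2) + m * (x ^+ 2 + y ^+ 2)); last by ring.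
by rewrite lerD// ler_pM ?normc_ge0.
Qed.

(** The extreme directions are x = y and x = -y: adding the nonnegative (|Re a| + Re a)(x - y)^2 and
    (|Re a| - Re a)(x + y)^2 bounds Re a * xy by |Re a| (x^2 + y^2) / 2. *)
Lemma Re_quadform_le (a b : R[i]) (m x y : R) : `|Re a| / 2 + m <= Re b ->
  Re (quadform a b x y) <= - (m * (x ^+ 2 + y ^+ 2)).
Proof.
move=> abm; rewrite cReD cReN !cReM /= !mulr0 !subr0.
have pn : 0 <= `|Re a| + Re a by have := ler_norm (- Re a); rewrite normrN; lra.
have np : 0 <= `|Re a| - Re a by have := ler_norm (Re a); lra.
have := mulr_ge0 pn (sqr_ge0 (x - y)); have := mulr_ge0 np (sqr_ge0 (x + y)).
have r0 : 0 <= x ^+ 2 + y ^+ 2 by rewrite addr_ge0 ?sqr_ge0.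
have q0 : 0 <= Re b - (`|Re a| / 2 + m) by lra.
have := mulr_ge0 q0 r0; lra.
Qed.

(** With t = a r / 4, the bounds t <= exp t and t^2 <= 4 exp t give r <= (4 / a) exp t and r^2 <=
    (64 / a^2) exp t. *)
Definition poly_const (a : R) := 1 + 4 / a + 64 / a ^+ 2.

Lemma poly_le_expR (a r : R) : 0 < a -> 0 <= r ->
  1 + r + r ^+ 2 <= poly_const a * expR (a / 4 * r).
Proof.
move=> a0 r0; set t := a / 4 * r.
have t0 : 0 <= t by rewrite mulr_ge0// divr_ge0// ltW.
have rE : r = 4 / a * t by rewrite /t; field; rewrite gt_eqF.
have e1 := expR_ge1Dx t; have e2 := expR_ge1Dx (t / 2).
have ee : expR t = expR (t / 2) ^+ 2 by rewrite -expRM_natl; congr expR; field.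
have e3 : t ^+ 2 / 4 <= expR t.
  by rewrite ee; move: (expR (t / 2)) e2 => E e2; nra.
have p0 : 0 < 4 / a by rewrite divr_gt0.
have h1 : r <= 4 / a * expR t by rewrite rE ler_wpM2l ?ltW//; lra.
have h2 : r ^+ 2 <= 64 / a ^+ 2 * expR t.
  rewrite rE (_ : _ ^+ 2 = 64 / a ^+ 2 * (t ^+ 2 / 4)); last by field; rewrite gt_eqF.
  by rewrite ler_wpM2l// divr_ge0// sqr_ge0.
rewrite /poly_const; lra.
Qed.

Lemma poly_const_ge0 (a : R) : 0 < a -> 0 <= poly_const a.
Proof. by move=> a0; rewrite !addr_ge0// ltW// divr_gt0// exprn_gt0. Qed.

(** Budget for the decay rate a: one quarter absorbs the perturbed exponent, one quarter the
    polynomial, and a / 2 remains. *)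
Lemma poly_gauss_le (a r : R) : 0 < a -> 0 <= r ->
  (1 + r + r ^+ 2) * expR (a / 4 * r) * expR (- (a * r)) <=
  poly_const a * expR (- (a / 2 * r)).
Proof.
move=> a0 r0; rewrite -mulrA -expRD.
rewrite (_ : expR (- (a / 2 * r)) = expR (a / 4 * r) * expR (a / 4 * r + - (a * r))).
  by rewrite mulrA ler_wpM2r ?expR_ge0// poly_le_expR.
by rewrite -expRD; congr expR; field.
Qed.

(* With [cexp (h p) = 1 + h p + rho], the quotient minus its limit equals
   [(u1 - l1) + v (p - P) + h u1 p + (v + h u1) rho / h]. *)
Lemma exp_quotient_bound (v u1 l1 p P h : R[i]) (L e r : R) :
  h != 0 -> 0 < e -> e <= 1 -> 1 <= L -> 0 <= r ->
  normc v <= L -> normc u1 <= L -> normc h <= e -> normc (u1 - l1) <= e ->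
  normc p <= 2 * L * r -> normc (p - P) <= 2 * e * r ->
  normc (((v + h * u1) * cexp (h * p) - v) / h - (l1 + v * P)) <=
  e * (46 * L ^+ 3) * (1 + r + r ^+ 2) * expR (2 * L * e * r).
Proof.
move=> h0 e0 e1 L1 r0 vL u1L he u1l pL pP.
pose rho := cexp (h * p) - 1 - h * p.
have L0 : 0 <= L by lra.
have hp : normc (h * p) <= 2 * L * e * r.
  rewrite normcM (_ : _ * r = e * (2 * L * r)); last by ring.
  by rewrite ler_pM ?normc_ge0.
have rhoh : normc (rho / h) <= 5 * e * (2 * L * r) ^+ 2 * expR (2 * L * e * r).
  rewrite normcM normcV ler_pdivrMr ?normc_gt0//.
  apply: le_trans (cexp_taylor (h * p)) _.
  have -> : 5 * e * (2 * L * r) ^+ 2 * expR (2 * L * e * r) * normc h =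
    5 * (normc h * (e * (2 * L * r) ^+ 2)) * expR (2 * L * e * r) by ring.
  apply: ler_pM; rewrite ?expR_ge0 ?mulr_ge0 ?normc_ge0//; last by rewrite ler_expR.
  rewrite ler_wpM2l// normcM exprMn expr2 -mulrA ler_wpM2l ?normc_ge0//.
  by rewrite ler_pM ?normc_ge0 ?sqr_ge0// ler_pXn2r ?nnegrE ?normc_ge0// ?mulr_ge0.
have -> : ((v + h * u1) * cexp (h * p) - v) / h - (l1 + v * P) =
    (u1 - l1) + v * (p - P) + h * (u1 * p) + (v + h * u1) * (rho / h).
  by rewrite /rho; field.
have E1 : 1 <= expR (2 * L * e * r) by rewrite -expR0 ler_expR !mulr_ge0// ltW.
set E := expR _ in rhoh E1 *.
have n2 : normc (v * (p - P)) <= L * (2 * e * r) by rewrite normcM ler_pM ?normc_ge0.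
have n3 : normc (h * (u1 * p)) <= e * (L * (2 * L * r)).
  by rewrite !normcM !ler_pM ?mulr_ge0 ?normc_ge0.
have n4 : normc (v + h * u1) <= 2 * L.
  apply: le_trans (le_normcD _ _) _; rewrite normcM mulrDl mul1r lerD//.
  by rewrite -[leRHS]mul1r ler_pM ?normc_ge0// (le_trans he).
have n5 : normc ((v + h * u1) * (rho / h)) <= 2 * L * (5 * e * (2 * L * r) ^+ 2 * E).
  by rewrite [X in X <= _]normcM ler_pM ?normc_ge0.
apply: le_trans (le_normcD _ _) _; apply: le_trans (lerD (le_normcD _ _) n5) _.
apply: le_trans (lerD (lerD (le_normcD _ _) n3) (lexx _)) _.
apply: le_trans (lerD (lerD (lerD u1l n2) (lexx _)) (lexx _)) _.
have LL : L <= L ^+ 3 by rewrite ler_eXnr.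
have LL2 : L ^+ 2 <= L ^+ 3 by rewrite ler_weXn2l.
have L31 : 1 <= L ^+ 3 by apply: le_trans LL.
(* The r^2 term requires 40. Since [1 <= L], the coefficients of lower degree are at most 4 L^3, so
   46 leaves room. *)
have -> : e + L * (2 * e * r) + e * (L * (2 * L * r)) +
    2 * L * (5 * e * (2 * L * r) ^+ 2 * E) =
    e * (1 + (2 * L + 2 * L ^+ 2) * r + 40 * L ^+ 3 * r ^+ 2 * E) by ring.
rewrite (_ : e * _ * _ * E = e * (46 * L ^+ 3 * (1 + r + r ^+ 2) * E)); last by ring.
rewrite ler_wpM2l ?(ltW e0)//.
have r2 := sqr_ge0 r.
have h1 : 1 + (2 * L + 2 * L ^+ 2) * r <= 46 * L ^+ 3 * (1 + r) * E.
  apply: (@le_trans _ _ (46 * L ^+ 3 * (1 + r))).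
    by move: (L ^+ 3) (L ^+ 2) LL LL2 L31 => A B; nra.
  by rewrite ler_peMr// !mulr_ge0 ?addr_ge0 ?exprn_ge0.
have h2 : 40 * L ^+ 3 * r ^+ 2 * E <= 46 * L ^+ 3 * r ^+ 2 * E.
  by rewrite !ler_wpM2r ?expR_ge0 ?exprn_ge0//; lra.
by rewrite mulrDr mulrDl lerD.
Qed.

(** Unfolds to [K] when the coefficients are [w1], [w2], [w3] along functions of the parameter. *)
Definition gauss_family (W1 W2 W3 : R[i] -> R[i]) (w : R[i]) (x y : R) : R[i] :=
  W1 w * cexp (quadform (W3 w) (W2 w) x y).

Lemma separately_continuous_gauss_family W1 W2 W3 w :
  separately_continuous (gauss_family W1 W2 W3 w).
Proof.
apply: separately_continuousM; first exact: separately_continuous_cst.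
exact/separately_continuous_cexp/separately_continuous_quadform.
Qed.

Section Derivative.
Variables (W1 W2 W3 : R[i] -> R[i]) (z l1 l2 l3 : R[i]) (L a : R).
Hypotheses (L1 : 1 <= L) (a0 : 0 < a).
Hypothesis Wz : `|Re (W3 z)| / 2 + a <= Re (W2 z).
(** The added 1 leaves room for the difference quotients of the weights, which lie within e <= 1 of
    their limits. *)
Hypotheses (W1L : normc (W1 z) <= L) (l1L : normc l1 + 1 <= L)
  (l2L : normc l2 + 1 <= L) (l3L : normc l3 + 1 <= L).

Let k := gauss_family W1 W2 W3.

(** The product rule for the kernel when l1, l2, l3 are the derivatives of the weights at z; the
    exponent is linear in its coefficients. *)
Definition gauss_family_deriv (x y : R) : R[i] :=
  (l1 + W1 z * quadform l3 l2 x y) * cexp (quadform (W3 z) (W2 z) x y).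

Lemma separately_continuous_deriv : separately_continuous gauss_family_deriv.
Proof.
apply: separately_continuousM.
  apply: separately_continuousD; first exact: separately_continuous_cst.
  apply: separately_continuousM; first exact: separately_continuous_cst.
  exact: separately_continuous_quadform.
exact/separately_continuous_cexp/separately_continuous_quadform.
Qed.

Let sq2_ge0 (x y : R) : 0 <= x ^+ 2 + y ^+ 2.
Proof. by rewrite addr_ge0 ?sqr_ge0. Qed.

Let normc_cexp_quadform x y :
  normc (cexp (quadform (W3 z) (W2 z) x y)) <= expR (- (a * (x ^+ 2 + y ^+ 2))).
Proof. by rewrite normc_cexp ler_expR Re_quadform_le. Qed.

Lemma gauss_family_bounded : gauss_bounded L (a / 2) (k z).
Proof.
move=> x y; rewrite normcM gaussM ler_pM ?normc_ge0//.
apply: le_trans (normc_cexp_quadform x y) _; rewrite ler_expR lerN2.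
by rewrite ler_wpM2r ?sq2_ge0//; have := a0; lra.
Qed.

Lemma gauss_family_deriv_bounded :
  gauss_bounded (3 * L ^+ 2 * poly_const a) (a / 2) gauss_family_deriv.
Proof.
move=> x y; set r := x ^+ 2 + y ^+ 2; have r0 : 0 <= r by exact: sq2_ge0.
rewrite normcM gaussM -/r -mulrA.
have lL l : normc l + 1 <= L -> normc l <= L by lra.
have h1 : normc (l1 + W1 z * quadform l3 l2 x y) <= 3 * L ^+ 2 * (1 + r + r ^+ 2).
  apply: le_trans (le_normcD _ _) _; rewrite normcM.
  apply: (@le_trans _ _ (L + L * (2 * L * r))).
    have q := normc_quadform_le _ _ _ x y (lL _ l3L) (lL _ l2L).
    by rewrite lerD ?lL// ler_pM ?normc_ge0.
  have LL : L <= L ^+ 2 by rewrite ler_eXnr.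
  have := mulr_ge0 (sqr_ge0 L) r0; have := mulr_ge0 (sqr_ge0 L) (sqr_ge0 r).
  by have := L1; lra.
have h2 : expR (- (a * r)) <= expR (a / 4 * r) * expR (- (a * r)).
  by rewrite ler_peMl ?expR_ge0// -expR0 ler_expR mulr_ge0// divr_ge0// ltW.
apply: (@le_trans _ _ (3 * L ^+ 2 * (1 + r + r ^+ 2) * (expR (a / 4 * r) * expR (- (a * r))))).
  by rewrite ler_pM ?normc_ge0// (le_trans (normc_cexp_quadform x y)).
have c0 : 0 <= 3 * L ^+ 2 by rewrite mulr_ge0 ?sqr_ge0.
rewrite -[leLHS]mulrA ler_wpM2l// mulrA.
exact: poly_gauss_le.
Qed.

Definition quotient_const := 46 * L ^+ 3 * poly_const a.

(** Factoring out the exponential at z leaves the expression of [exp_quotient_bound], with the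
    difference quotients of the weights in p. The condition [2 * L * e <= a / 4] keeps its growth
    within the quarter of the decay reserved by [poly_gauss_le]. *)
Lemma gauss_family_quotient_bounded (e : R) (w : R[i]) : w != z ->
  0 < e -> e <= 1 -> 2 * L * e <= a / 4 ->
  normc (w - z) <= e ->
  normc (W1 w - W1 z - l1 * (w - z)) <= e * normc (w - z) ->
  normc (W2 w - W2 z - l2 * (w - z)) <= e * normc (w - z) ->
  normc (W3 w - W3 z - l3 * (w - z)) <= e * normc (w - z) ->
  gauss_bounded (e * quotient_const) (a / 2)
    (fun x y => (k w x y - k z x y) / (w - z) - gauss_family_deriv x y).
Proof.
move=> wz e0 e1 Le he H1 H2 H3 x y.
have h0 : w - z != 0 by rewrite subr_eq0.
set h := w - z in h0 he H1 H2 H3 *.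
set r := x ^+ 2 + y ^+ 2; have r0 : 0 <= r by exact: sq2_ge0.
have uP (W : R[i] -> R[i]) l : normc l + 1 <= L ->
    normc (W w - W z - l * h) <= e * normc h ->
    [/\ normc ((W w - W z) / h - l) <= e, normc ((W w - W z) / h) <= L &
      W w = W z + h * ((W w - W z) / h)].
  move=> lL Hl; have ul : normc ((W w - W z) / h - l) <= e.
    rewrite (_ : _ - l = (W w - W z - l * h) / h); last by field.
    by rewrite normcM normcV ler_pdivrMr ?normc_gt0.
  split=> //; last by field.
  rewrite -[X in normc X](subrK l); apply: le_trans (le_normcD _ _) _; lra.
have [u1l u1L W1E] := uP W1 l1 l1L H1.
have [u2l u2L W2E] := uP W2 l2 l2L H2.
have [u3l u3L W3E] := uP W3 l3 l3L H3.
move: ((W1 w - W1 z) / h) u1l u1L W1E => u1 u1l u1L W1E.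
move: ((W2 w - W2 z) / h) u2l u2L W2E => u2 u2l u2L W2E.
move: ((W3 w - W3 z) / h) u3l u3L W3E => u3 u3l u3L W3E.
have quadD : quadform (W3 w) (W2 w) x y =
    quadform (W3 z) (W2 z) x y + h * quadform u3 u2 x y.
  by rewrite /quadform W2E W3E; ring.
have quadB : quadform u3 u2 x y - quadform l3 l2 x y = quadform (u3 - l3) (u2 - l2) x y.
  by rewrite /quadform; ring.
have -> : (k w x y - k z x y) / h - gauss_family_deriv x y =
    cexp (quadform (W3 z) (W2 z) x y) *
    (((W1 z + h * u1) * cexp (h * quadform u3 u2 x y) - W1 z) / h -
     (l1 + W1 z * quadform l3 l2 x y)).
  by rewrite /k /gauss_family /gauss_family_deriv quadD cexpD W1E; field.
rewrite normcM gaussM -/r.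
have := @exp_quotient_bound (W1 z) u1 l1 (quadform u3 u2 x y) (quadform l3 l2 x y) h L e r
  h0 e0 e1 L1 r0 W1L u1L he u1l (normc_quadform_le _ _ _ _ _ u3L u2L) _.
rewrite quadB => /(_ (normc_quadform_le _ _ _ _ _ u3l u2l)) Q.
rewrite mulrC; apply: le_trans (ler_pM (normc_ge0 _) (normc_ge0 _) Q (normc_cexp_quadform x y)) _.
rewrite -/r /quotient_const.
have hE : expR (2 * L * e * r) <= expR (a / 4 * r) by rewrite ler_expR ler_wpM2r.
have L0 : 0 <= L := le_trans ler01 L1.
have eL : 0 <= e * (46 * L ^+ 3) by rewrite !mulr_ge0 ?exprn_ge0// ltW.
rewrite [leLHS](_ : _ = e * (46 * L ^+ 3) *
  ((1 + r + r ^+ 2) * expR (2 * L * e * r) * expR (- (a * r)))); last by ring.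
rewrite [leRHS](_ : _ = e * (46 * L ^+ 3) * (poly_const a * expR (- (a / 2 * r)))); last by ring.
rewrite ler_wpM2l//; apply: le_trans (poly_gauss_le _ _ a0 r0).
by rewrite ler_wpM2r ?expR_ge0// ler_wpM2l// addr_ge0 ?sqr_ge0// addr_ge0.
Qed.

End Derivative.

Local Notation mu := (@lebesgue_measure R).

Lemma ecvg0 (F : set_system R[i]) {FF : Filter F} (f : R[i] -> \bar R) :
  (forall w, (0 <= f w)%E) ->
  (forall e : R, 0 < e -> \forall w \near F, (f w <= e%:E)%E) ->
  f w @[w --> F] --> 0%E.
Proof.
move=> f0 fe; apply/fine_cvgP; split.
  have := fe 1 ltr01; apply: filterS => w fw.
  by rewrite ge0_fin_numE// (le_lt_trans fw)// ltry.
apply/cvgrPdist_le => e e0; have := fe e e0; apply: filterS => w fw.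
rewrite /= sub0r normrN ger0_norm ?fine_ge0//.
by rewrite -lee_fin fineK// ge0_fin_numE// (le_lt_trans fw)// ltry.
Qed.

Lemma gauss_bounded_le (M M' d : R) k : M <= M' -> gauss_bounded M d k ->
  gauss_bounded M' d k.
Proof.
move=> MM kM x y; apply: le_trans (kM x y) _.
by rewrite ler_wpM2r// mulr_ge0// ltW// gauss_gt0.
Qed.

Lemma gauss_boundedD (M M' d : R) k k' : gauss_bounded M d k -> gauss_bounded M' d k' ->
  gauss_bounded (M + M') d (fun x y => k x y + k' x y).
Proof.
move=> kM kM' x y; apply: le_trans (le_normcD _ _) _.
by rewrite mulrDl lerD.
Qed.

Lemma gauss_boundedZ (M d : R) (a : R[i]) k : gauss_bounded M d k ->
  gauss_bounded (normc a * M) d (fun x y => a * k x y).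
Proof. by move=> kM x y; rewrite normcM -mulrA ler_wpM2l ?normc_ge0. Qed.

Lemma integral_operatorD k k' f x : L2 f ->
  integral_operator_defined k -> integral_operator_defined k' ->
  integral_operator (fun x y => k x y + k' x y) f x =
  integral_operator k f x + integral_operator k' f x.
Proof.
move=> Lf kd kd'.
rewrite /integral_operator -cintegralD; [|exact: kd|exact: kd'].
by apply: eq_cintegral => y; rewrite mulrDl.
Qed.

Lemma integral_operatorZ (a : R[i]) k f x : L2 f -> integral_operator_defined k ->
  integral_operator (fun x y => a * k x y) f x = a * integral_operator k f x.
Proof.
move=> Lf kd; rewrite /integral_operator -cintegralZ; last exact: kd.
by apply: eq_cintegral => y; rewrite mulrA.
Qed.

Lemma integral_operator0 (f : R -> R[i]) x : integral_operator (fun _ _ => 0) f x = 0.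
Proof.
rewrite /integral_operator (eq_cintegral _ (fun=> 0)); last by move=> y; rewrite mul0r.
by apply: complexP; rewrite /= Rintegral_cst// mul0r.
Qed.

(** Near z the kernel is (w - z) (q + k') + k z, where k' is the derivative kernel and q has a small
    Gaussian bound. Operator norms of q and k' yield both limits. *)
Lemma gauss_family_norm_differentiable (W1 W2 W3 : R[i] -> R[i]) (z : R[i]) :
  cdiff W1 z -> cdiff W2 z -> cdiff W3 z -> `|Re (W3 z)| / 2 < Re (W2 z) ->
  let F w := integral_operator (gauss_family W1 W2 W3 w) in
  [/\ integral_operator_defined (gauss_family W1 W2 W3 z), hilbert_schmidt (F z),
    opnorm (fun f x => F w f x - F z f x) @[w --> (z : R[i]^o)] --> 0%E &
    exists2 F' : (R -> R[i]) -> (R -> R[i]), bounded_operator F' &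
      opnorm (fun f x => (F w f x - F z f x) / (w - z) - F' f x)
        @[w --> (z : R[i]^o)^'] --> 0%E].
Proof.
move=> /cdiffP[l1 D1] /cdiffP[l2 D2] /cdiffP[l3 D3] W32 F.
set k := gauss_family W1 W2 W3.
pose a := Re (W2 z) - `|Re (W3 z)| / 2.
have a0 : 0 < a by rewrite subr_gt0.
have Wz : `|Re (W3 z)| / 2 + a <= Re (W2 z) by rewrite /a; lra.
pose L := 1 + normc (W1 z) + normc l1 + normc l2 + normc l3.
have := normc_ge0 (W1 z); have := normc_ge0 l1; have := normc_ge0 l2; have := normc_ge0 l3.
move=> n3 n2 n1 nW.
have L1 : 1 <= L by rewrite /L; lra.
have L0 : 0 < L by exact: lt_le_trans L1.
have W1L : normc (W1 z) <= L by rewrite /L; lra.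
have l1L : normc l1 + 1 <= L by rewrite /L; lra.
have l2L : normc l2 + 1 <= L by rewrite /L; lra.
have l3L : normc l3 + 1 <= L by rewrite /L; lra.
have d0 : 0 < a / 2 by lra.
pose d := a / 2; pose k' := gauss_family_deriv W1 W2 W3 z l1 l2 l3.
have ck w : separately_continuous (k w) by exact: separately_continuous_gauss_family.
have ck' : separately_continuous k' by exact: separately_continuous_deriv.
have bk : gauss_bounded L d (k z) by exact: gauss_family_bounded.
pose C' := 3 * L ^+ 2 * poly_const a.
have bk' : gauss_bounded C' d k' by exact: gauss_family_deriv_bounded.
have C'0 : 0 <= C' by exact: gauss_bounded_ge0 bk'.
pose C := quotient_const L a.
pose G : R := \int[mu]_x gauss (2 * d) x.
have G0 : 0 <= G by apply: Rintegral_ge0 => x _; exact/ltW/gauss_gt0.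
have C0 : 0 <= C by rewrite /C /quotient_const !mulr_ge0 ?poly_const_ge0 ?exprn_ge0// ltW.
pose q w x y := (k w x y - k z x y) / (w - z) - k' x y.
have quot e : 0 < e -> \forall w \near (z : R[i]^o), w != z ->
    gauss_bounded (e * C) d (q w) /\ normc (w - z) <= e.
  (* The bound 1 is required by the Taylor estimate; a / (8 L) secures [2 * L * e' <= a / 4]. *)
  move=> e0; pose e' := Num.min e (Num.min 1 (a / (8 * L))).
  have e'0 : 0 < e' by rewrite !lt_min e0 ltr01 divr_gt0// mulr_gt0.
  have e'e : e' <= e by rewrite ge_min lexx.
  have e'1 : e' <= 1 by rewrite !ge_min lexx orbT.
  have e'a : 2 * L * e' <= a / 4.
    have : e' <= a / (8 * L) by rewrite !ge_min lexx !orbT.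
    rewrite ler_pdivlMr ?mulr_gt0// => h; rewrite ler_pdivlMr//.
    by rewrite (_ : _ * 4 = e' * (8 * L))//; ring.
  have /near_normcP[d1 d10 H1] := D1 _ e'0.
  have /near_normcP[d2 d20 H2] := D2 _ e'0.
  have /near_normcP[d3 d30 H3] := D3 _ e'0.
  apply/near_normcP; exists (Num.min (Num.min d1 d2) (Num.min d3 e')).
    by rewrite 3!lt_min d10 d20 d30 e'0.
  move=> w; rewrite 3!lt_min => /andP[/andP[/H1 h1 /H2 h2] /andP[/H3 h3 /ltW h4]] wz.
  split; last exact: le_trans h4 e'e.
  apply: (gauss_bounded_le (e' * C)); first by rewrite ler_wpM2r.
  exact: gauss_family_quotient_bounded.
have kwE w : w != z -> k w = fun x y => (w - z) * (q w x y + k' x y) + k z x y.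
  move=> wz; have wz0 : w - z != 0 by rewrite subr_eq0.
  by apply/funext => x; apply/funext => y; rewrite /q; field.
have cq w : separately_continuous (q w).
  rewrite (_ : q w = fun x y => (w - z)^-1 * (k w x y + (-1) * k z x y) + (-1) * k' x y).
    have cZ (b : R[i]) j : separately_continuous j ->
        separately_continuous (fun x y => b * j x y).
      by move=> cj; apply: separately_continuousM => //; exact: separately_continuous_cst.
    exact: (separately_continuousD _ _
      (cZ _ _ (separately_continuousD _ _ (ck w) (cZ _ _ (ck z)))) (cZ _ _ ck')).
  by apply/funext => x; apply/funext => y; rewrite /q; ring.
have defk : integral_operator_defined (k z) by exact: gauss_kernel_defined bk.
have defk' : integral_operator_defined k' by exact: gauss_kernel_defined bk'.
(* Convergence of the integral at w is inherited from [q w], [k'] and [k z] through [kwE]. *)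
have FwE w f x : w != z -> L2 f -> integral_operator_defined (q w) ->
    F w f x - F z f x = (w - z) * (integral_operator (q w) f x + integral_operator k' f x).
  move=> wz Lf qd; rewrite /F -/k [in LHS]kwE//.
  have qk'd : integral_operator_defined (fun x y => q w x y + k' x y).
    move=> g Lg u; have := cintegrableD _ _ (qd g Lg u) (defk' g Lg u).
    by under eq_fun do rewrite -mulrDl.
  have hqk'd : integral_operator_defined (fun x y => (w - z) * (q w x y + k' x y)).
    move=> g Lg u; have := cintegrableZ (w - z) _ (qk'd g Lg u).
    by under eq_fun do rewrite mulrA.
  by rewrite integral_operatorD// addrK integral_operatorZ// integral_operatorD.
split => //; first exact: gauss_kernel_hilbert_schmidt bk.
- apply: (@ecvg0 (nbhs (z : R[i]^o)) _) => [w|e e0]; first exact: opnorm_ge0.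
  (* The difference has norm at most |w - z| (e1 C + C') G, hence at most e1 (C + C') G; the added 1
     keeps the denominator positive. *)
  pose e1 := Num.min 1 (e / ((C + C') * G + 1)).
  have den0 : 0 < (C + C') * G + 1 by have := mulr_ge0 (addr_ge0 C0 C'0) G0; lra.
  have e10 : 0 < e1 by rewrite lt_min ltr01 divr_gt0.
  have e11 : e1 <= 1 by rewrite ge_min lexx.
  have e1e : e1 * ((C + C') * G + 1) <= e.
    by rewrite -ler_pdivlMr// ge_min lexx orbT.
  have := quot e1 e10; apply: filterS => w qw.
  (* The neighbourhood contains z, where the quotient kernel gives no information and the difference
     is the zero operator. *)
  have [->|wz] := eqVneq w z.
    rewrite (_ : (fun f x => F z f x - F z f x) = integral_operator (fun _ _ => 0)).
      have b0 : gauss_bounded 0 d (fun _ _ => 0 : R[i]) by move=> x y; rewrite normc0 mul0r.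
      apply: le_trans (gauss_kernel_opnorm _ _ _ d0 (separately_continuous_cst 0) b0) _.
      by rewrite mul0r lee_fin ltW.
    by apply/funext => f; apply/funext => x; rewrite subrr integral_operator0.
  have [bq wze] := qw wz.
  have qd : integral_operator_defined (q w) by exact: gauss_kernel_defined bq.
  have bqk' := gauss_boundedZ _ _ (w - z) _ (gauss_boundedD _ _ _ _ _ bq bk').
  rewrite (eq_opnorm _ (integral_operator (fun x y => (w - z) * (q w x y + k' x y)))).
    have cqk' : separately_continuous (fun x y => (w - z) * (q w x y + k' x y)).
      apply: separately_continuousM; first exact: separately_continuous_cst.
      exact: separately_continuousD.
    apply: le_trans (gauss_kernel_opnorm _ _ _ d0 cqk' bqk') _.
    rewrite lee_fin -/G; apply: le_trans e1e.
    rewrite -mulrA ler_pM ?normc_ge0 ?mulr_ge0 ?addr_ge0//; first by rewrite mulr_ge0// ltW.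
    apply: (@le_trans _ _ ((C + C') * G)); last by rewrite lerDl.
    by rewrite ler_wpM2r// lerD2r ler_piMl.
  move=> f Lf x; rewrite FwE//.
  have qk'd : integral_operator_defined (fun x y => q w x y + k' x y).
    move=> g Lg u; have := cintegrableD _ _ (qd g Lg u) (defk' g Lg u).
    by under eq_fun do rewrite -mulrDl.
  rewrite (integral_operatorZ (w - z) (fun x y => q w x y + k' x y))//.
  by rewrite (integral_operatorD (q w) k').
- exists (integral_operator k'); first exact: gauss_kernel_bounded bk'.
  apply: (@ecvg0 ((z : R[i]^o)^') _) => [w|e e0]; first exact: opnorm_ge0.
  have den0 : 0 < C * G + 1 by have := mulr_ge0 C0 G0; lra.
  have := quot (e / (C * G + 1)) (divr_gt0 e0 den0).
  apply: filterS => w qw wz; have [bq _] := qw wz.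
  have qd : integral_operator_defined (q w) by exact: gauss_kernel_defined bq.
  rewrite (eq_opnorm _ (integral_operator (q w))).
    apply: le_trans (gauss_kernel_opnorm _ _ _ d0 (cq w) bq) _.
    rewrite lee_fin -/G -mulrA mulrAC ler_pdivrMr// ler_wpM2l ?ltW//; lra.
  move=> f Lf x; rewrite FwE// mulrAC mulfV ?subr_eq0// mul1r.
  by rewrite addrK.
Qed.

End GaussianFamily.

(** * Holomorphy of the weights *)

Section DifferentiabilityRules.

Section GenericField.
Variable K : numFieldType.
Implicit Types (f g : K^o -> K^o) (z : K^o).

Lemma differentiable_fieldM f g z : differentiable f z -> differentiable g z ->
  differentiable (fun w : K^o => f w * g w : K^o) z.
Proof. exact: differentiableM. Qed.

Lemma differentiable_fieldD f g z : differentiable f z -> differentiable g z ->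
  differentiable (fun w : K^o => f w + g w : K^o) z.
Proof. exact: differentiableD. Qed.

Lemma differentiable_fieldN f z : differentiable f z ->
  differentiable (fun w : K^o => - f w : K^o) z.
Proof. exact: differentiableN. Qed.

Lemma differentiable_fieldV f z : differentiable f z -> f z != 0 ->
  differentiable (fun w : K^o => (f w)^-1 : K^o) z.
Proof. exact: differentiableV. Qed.

Lemma differentiable_field_comp f g z : differentiable f z -> differentiable g (f z) ->
  differentiable (fun w : K^o => g (f w)) z.
Proof. exact: differentiable_comp. Qed.

Lemma differentiable_field_cst (a : K^o) z : differentiable (fun _ : K^o => a) z.
Proof. exact: differentiable_cst. Qed.

Lemma differentiable_field_id z : differentiable (fun w : K^o => w) z.
Proof. exact: ex_diff. Qed.

End GenericField.

Context {R : realType}.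
Implicit Types (f g : R[i] -> R[i]) (z w : R[i]).

Lemma cdiffM f g z : cdiff f z -> cdiff g z -> cdiff (fun w => f w * g w) z.
Proof. exact: differentiable_fieldM. Qed.

Lemma cdiffD f g z : cdiff f z -> cdiff g z -> cdiff (fun w => f w + g w) z.
Proof. exact: differentiable_fieldD. Qed.

Lemma cdiffN f z : cdiff f z -> cdiff (fun w => - f w) z.
Proof. exact: differentiable_fieldN. Qed.

Lemma cdiffV f z : cdiff f z -> f z != 0 -> cdiff (fun w => (f w)^-1) z.
Proof. exact: differentiable_fieldV. Qed.

Lemma cdiff_comp f g z : cdiff f z -> cdiff g (f z) -> cdiff (fun w => g (f w)) z.
Proof. exact: differentiable_field_comp. Qed.

Lemma cdiff_cst (a : R[i]) z : cdiff (fun=> a) z.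
Proof. exact: differentiable_field_cst. Qed.

Lemma cdiff_id z : cdiff (fun w => w) z.
Proof. exact: differentiable_field_id. Qed.

(** By the functional equation the error is exp z times the Taylor remainder at w - z. *)
Lemma cdiff_cexp z : cdiff cexp z.
Proof.
apply/cdiffP; exists (cexp z) => e e0; apply/near_normcP.
pose E := 5 * expR 1 * normc (cexp z) : R.
have E0 : 0 < E by rewrite !mulr_gt0 ?expR_gt0// normc_gt0 cexp_neq0.
exists (Num.min 1 (e / E)) => [|w]; first by rewrite lt_min ltr01 divr_gt0.
rewrite lt_min => /andP[w1]; rewrite ltr_pdivlMr// => we.
set h := w - z in w1 we *.
have -> : cexp w - cexp z - cexp z * h = cexp z * (cexp h - 1 - h).
  by rewrite -[w](subrK z) -/h cexpD; ring.
rewrite normcM.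
have := cexp_taylor h; have := normc_ge0 h; set n := normc h in w1 we *.
move=> n0 T; apply: le_trans (ler_wpM2l (normc_ge0 _) T) _.
apply: (@le_trans _ _ (n * E * n)); last by rewrite ler_wpM2r// ltW.
rewrite /E (_ : n * _ * n = normc (cexp z) * (5 * n ^+ 2 * expR 1)); last by ring.
by rewrite ler_wpM2l ?normc_ge0// ler_wpM2l ?mulr_ge0 ?sqr_ge0// ler_expR ltW.
Qed.

End DifferentiabilityRules.

(** * Principal logarithm and powers in the right half-plane *)

Section Logarithm.
Context {R : realType}.
Implicit Types (z w c : R[i]).

Lemma Re_div_normc_itv z : -1 <= Re z / normc z <= 1.
Proof.
have [->|z0] := eqVneq z 0; first by rewrite normc0 invr0 mulr0 lerN10 ler01.
have n0 : 0 < normc z by rewrite normc_gt0.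
rewrite ler_pdivlMr// ler_pdivrMr// mulN1r mul1r -ler_norml.
exact: ler_Re_normc.
Qed.

Lemma cos_arg z : z != 0 -> normc z * cos (arg z) = Re z.
Proof.
move=> z0; have n0 : normc z != 0 by rewrite normc_eq0.
have aK : cos (acos (Re z / normc z)) = Re z / normc z.
  by apply: acosK; rewrite in_itv/= Re_div_normc_itv.
by rewrite /arg; case: ifP => _; rewrite ?cosN aK mulrC divfK.
Qed.

Lemma sin_arg z : z != 0 -> normc z * sin (arg z) = Im z.
Proof.
move=> z0; have n0 : 0 < normc z by rewrite normc_gt0.
have sE : normc z * sin (acos (Re z / normc z)) = `|Im z|.
  rewrite sin_acos ?Re_div_normc_itv//.
  rewrite -{1}(ger0_norm (normc_ge0 z)) -sqrtr_sqr -sqrtrM ?sqr_ge0//.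
  rewrite mulrBr mulr1 exprMn exprVn mulrCA mulfV ?mulr1; last first.
    by rewrite expf_neq0// gt_eqF.
  by rewrite sqr_normcE addrAC subrr add0r sqrtr_sqr.
rewrite /arg; case: ifP => i0; first by rewrite sE ger0_norm.
by rewrite sinN mulrN sE ltr0_norm ?opprK// ltNge i0.
Qed.

Lemma cexp_clog z : z != 0 -> cexp (clog z) = z.
Proof.
move=> z0; have n0 : 0 < normc z by rewrite normc_gt0.
by apply: complexP; rewrite /cexp /clog /= lnK// ?cos_arg// sin_arg.
Qed.

Lemma arg_Re_gt0 z : 0 < Re z -> - (pi / 2) < arg z < pi / 2.
Proof.
move=> z0; have z0' : z != 0 by apply: contraTneq z0 => ->; rewrite ltxx.
have n0 : 0 < normc z by rewrite normc_gt0.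
have xi := Re_div_normc_itv z; have pi0 := pi_gt0 R.
have h1 : acos (Re z / normc z) < pi / 2.
  rewrite -ltr_cos ?in_itv/= ?acos_ge0 ?acos_lepi//; last first.
    by apply/andP; split; lra.
  by rewrite cos_pihalf acosK ?in_itv//= divr_gt0.
have h0 := acos_ge0 xi.
by rewrite /arg; case: ifP => _; apply/andP; split; lra.
Qed.

(** A single formula on the right half-plane, without the case split on the sign of Im z, so
    continuity across the positive axis is visible. *)
Lemma argE z : 0 < Re z -> arg z = asin (Im z / normc z).
Proof.
move=> z0; have z0' : z != 0 by apply: contraTneq z0 => ->; rewrite ltxx.
have /andP[a1 a2] := arg_Re_gt0 z z0.
rewrite -(sin_arg z z0') mulrAC mulfV ?normc_eq0// mul1r sinK//.
by rewrite in_itv/= !ltW.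
Qed.

Lemma continuous_dist (f : R -> R) a : {for a, continuous f} ->
  forall e, 0 < e -> exists2 d, 0 < d & forall x, `|x - a| < d -> `|f x - f a| <= e.
Proof.
move=> /cvgrPdist_le fa e /fa/nbhs_ballP[d /= d0 H]; exists d => // x xa.
by rewrite distrC; apply: H; rewrite /ball /= distrC.
Qed.

Lemma clog_cvg z : 0 < Re z -> forall e : R, 0 < e ->
  \forall w \near (z : R[i]^o), normc (clog w - clog z) <= e.
Proof.
move=> z0 e e0.
have z0' : z != 0 by apply: contraTneq z0 => ->; rewrite ltxx.
have n0 : 0 < normc z by rewrite normc_gt0.
have e2 : 0 < e / 2 by rewrite divr_gt0.
have [d1 d10 H1] := continuous_dist (@ln R) (normc z) (continuous_ln n0) (e / 2) e2.
have zi : -1 < Im z / normc z < 1.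
  rewrite ltr_pdivlMr// ltr_pdivrMr// mulN1r mul1r -ltr_norml.
  rewrite -(ltr_pXn2r (n := 2))// ?nnegrE ?normc_ge0// real_normK ?num_real//.
  by rewrite sqr_normcE ltrDr exprn_gt0.
have [d2 d20 H2] := continuous_dist asin _ (continuous_asin zi) (e / 2) e2.
apply/near_normcP; exists (Num.min (Num.min d1 (d2 * normc z / 2)) (Re z)).
  by rewrite !lt_min d10 z0 divr_gt0// mulr_gt0.
move=> w; rewrite !lt_min => /andP[/andP[h1 h2] h3].
have w0 : 0 < Re w.
  have := ler_Re_normc (w - z); rewrite cReD cReN.
  have := ler_norm (- (Re w - Re z)); rewrite normrN; lra.
have nw0 : 0 < normc w.
  by rewrite normc_gt0; apply: contraTneq w0 => ->; rewrite ltxx.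
have nwz : `|normc w - normc z| <= normc (w - z).
  rewrite ler_norml; apply/andP; split.
    by have := le_normcD (z - w) w; rewrite subrK (normc_distC z); lra.
  by have := le_normcD (w - z) z; rewrite subrK; lra.
have iwz : `|Im w / normc w - Im z / normc z| < d2.
  (* Both terms of the numerator are at most |w - z|, which explains the radius d2 |z| / 2. *)
  rewrite (_ : _ - _ = (Im w - Im z + Im w / normc w * (normc z - normc w)) / normc z); last first.
    by field; rewrite !gt_eqF.
  rewrite normrM normfV (gtr0_norm n0) ltr_pdivrMr//.
  apply: le_lt_trans (ler_normD _ _) _.
  have i1 : `|Im w - Im z| <= normc (w - z) by rewrite -cImN -cImD ler_Im_normc.
  have i2 : `|Im w / normc w * (normc z - normc w)| <= normc (w - z).
    rewrite normrM distrC -[leRHS]mul1r ler_pM//.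
    by rewrite normrM normfV (gtr0_norm nw0) ler_pdivrMr// mul1r ler_Im_normc.
  lra.
apply: le_trans (ler_normcReIm _) _; rewrite cReD cImD cReN cImN /=.
rewrite !argE//; have := H1 (normc w) (le_lt_trans nwz h1); have := H2 _ iwz; lra.
Qed.

(** Differentiation of an inverse function: with D the increment of the logarithm, w - z = z (D + r)
    and the error is -r, quadratic in D. Continuity makes D small, hence comparable to (w - z) /
    z. *)
Lemma cdiff_clog z : 0 < Re z -> cdiff clog z.
Proof.
move=> z0; have z0' : z != 0 by apply: contraTneq z0 => ->; rewrite ltxx.
have n0 : 0 < normc z by rewrite normc_gt0.
apply/cdiffP; exists z^-1 => e e0.
pose k : R := 5 * expR 1; have k0 : 0 < k by rewrite mulr_gt0// expR_gt0.
(* The three bounds on |D| respectively control the exponential in the remainder, give |D| <= 2 |D +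
   r|, and yield the factor e. *)
pose d : R := Num.min 1 (Num.min (2 * k)^-1 (e * normc z / (2 * k))).
have d0 : 0 < d.
  by rewrite !lt_min ltr01 invr_gt0 divr_gt0 ?mulr_gt0.
have /near_normcP[d1 d10 H] := clog_cvg z z0 d d0.
apply/near_normcP; exists (Num.min d1 (normc z)); first by rewrite lt_min d10.
move=> w; rewrite lt_min => /andP[/H wd wz].
have w0 : w != 0 by apply: contraTneq wz => ->; rewrite sub0r normcN ltxx.
set D := clog w - clog z in wd *.
have DE : w = z * cexp D by rewrite cexpD cexpN !cexp_clog// mulrCA mulfV ?mulr1.
pose r := cexp D - 1 - D.
have whr : w - z = z * (D + r) by rewrite {1}DE /r; ring.
have -> : D - z^-1 * (w - z) = - r by rewrite whr mulrA mulVf// mul1r; ring.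
rewrite normcN.
move: wd; rewrite /d !le_min => /and3P[D1 D2 D3].
have Dn0 := normc_ge0 D.
have rD : normc r <= k * normc D ^+ 2.
  apply: le_trans (cexp_taylor D) _.
  rewrite /k (_ : 5 * expR 1 * _ = 5 * normc D ^+ 2 * expR 1); last by ring.
  by rewrite ler_wpM2l ?mulr_ge0 ?sqr_ge0// ler_expR.
have kD : k * normc D <= 1 / 2.
  rewrite -[leRHS](_ : k * (2 * k)^-1 = _); first by rewrite ler_wpM2l// ltW.
  by field; rewrite gt_eqF.
have kD2 : k * normc D * 2 <= e * normc z.
  by move: D3; rewrite ler_pdivlMr ?mulr_gt0// => D3; lra.
have Dr : normc D <= 2 * normc (D + r).
  have := le_normcD (D + r) (- r); rewrite addrK normcN.
  have : normc r <= normc D / 2.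
    apply: le_trans rD _; rewrite expr2 mulrA; have := ler_wpM2r Dn0 kD; lra.
  lra.
apply: le_trans rD _; rewrite whr normcM.
have nDr := normc_ge0 (D + r).
apply: (@le_trans _ _ (k * normc D * (2 * normc (D + r)))).
  by rewrite expr2 mulrA ler_wpM2l// mulr_ge0// ltW.
rewrite !mulrA ler_wpM2r//; lra.
Qed.

Lemma cdiff_cpow c (a : R) : 0 < Re c -> cdiff (cpow ^~ a) c.
Proof.
move=> c0; apply: (cdiff_comp (fun c => a%:C * clog c) cexp); last exact: cdiff_cexp.
by apply: cdiffM; [exact: cdiff_cst|exact: cdiff_clog].
Qed.

Lemma sqr_cpow2V c : c != 0 -> cpow c 2^-1 ^+ 2 = c.
Proof.
move=> c0; rewrite expr2 -cexpD -[RHS]cexp_clog//; congr cexp.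
by rewrite -mulrDl -rmorphD -[RHS]mul1r; congr (_ * _); congr (_%:C); field.
Qed.

Lemma Re_cpow2V_gt0 c : 0 < Re c -> 0 < Re (cpow c 2^-1).
Proof.
move=> /arg_Re_gt0/andP[a1 a2]; have pi0 := pi_gt0 R.
have E : Im ((2^-1)%:C * clog c) = 2^-1 * arg c by rewrite cImM /= mul0r addr0.
rewrite -[Re _]/(expR (Re ((2^-1)%:C * clog c)) * cos (Im ((2^-1)%:C * clog c))) E.
rewrite mulr_gt0 ?expR_gt0// cos_gt0_pihalf//.
by apply/andP; split; lra.
Qed.

End Logarithm.

(** * Admissible parameters *)

Section Admissible.
Context {R : realType}.
Implicit Types (z w c tau : R[i]).

(** The difference of the two sides has derivative 2 cosh y - 2, positive for y > 0. *)
Lemma sinh_gt_id (x : R) : 0 < x -> 2 * x < expR x - expR (- x).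
Proof.
move=> x0; pose f y : R := expR y - expR (- y) - 2 * y.
pose df y : R := expR y + expR (- y) - 2.
have fdf y : is_derive y (1 : R) f (df y).
  rewrite /f /df; apply: is_derive_eq; rewrite /GRing.scale /=; ring.
have cf : {within `[0, x], continuous f}.
  by apply: continuous_subspaceT => y; apply: differentiable_continuous; apply/derivable1_diffP.
have [c] := MVT x0 (fun y _ => fdf y) cf.
rewrite in_itv/= => /andP[c0 _]; rewrite {1 2}/f oppr0 expR0 mulr0 => fE.
have d0 : 0 < df c.
  have := expR_gt1Dx (lt0r_neq0 c0); have := expR_ge1Dx (- c).
  by rewrite /df; lra.
have := mulr_gt0 d0 x0; lra.
Qed.

Lemma Re_div z w : w != 0 -> Re (z / w) = Re (z * w^*) / normc w ^+ 2.
Proof.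
move=> w0; have n0 : normc w ^+ 2 != 0 by rewrite expf_neq0// normc_eq0.
have E : w * w^* = (normc w ^+ 2)%:C.
  by apply: complexP; rewrite ?sqr_normcE ?cReM ?cImM cReJ cImJ /=; ring.
have -> : z / w = z * w^* * (normc w ^- 2)%:C.
  apply: (mulIf w0); rewrite divfK// -!mulrA [_%:C * w]mulrC mulrA -mulrA [w^* * _]mulrA.
  by rewrite [w^* * w]mulrC E -rmorphM mulfV// mulr1.
by rewrite [LHS]cReM /= mulr0 subr0.
Qed.

(* [0 < a] and [|bq| <= ap], where [cpow c 2^-1 = p + iq] and
   [cpow c 2^-1 * tau = a + ib]. *)
Definition admissible c tau :=
  0 < Re (cpow c 2^-1 * tau) /\
  `|Im (cpow c 2^-1 * tau) * Im (cpow c 2^-1)| <=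
    Re (cpow c 2^-1 * tau) * Re (cpow c 2^-1).

Lemma Re_mul2 z : Re (2 * z) = 2 * Re z.
Proof. by rewrite mulr_natl mulr2n cReD mulr_natl mulr2n. Qed.

Lemma Im_mul2 z : Im (2 * z) = 2 * Im z.
Proof. by rewrite mulr_natl mulr2n cImD mulr_natl mulr2n. Qed.

Lemma normc_lam c tau : normc (lam c tau) = expR (- (2 * Re (cpow c 2^-1 * tau))).
Proof.
by rewrite normc_cexp cReN -mulrA Re_mul2.
Qed.

Lemma Im_lam_le c tau :
  `|Im (lam c tau)| <= normc (lam c tau) * (2 * `|Im (cpow c 2^-1 * tau)|).
Proof.
rewrite normc_cexp.
rewrite -[Im _]/(expR (Re (- (2 * cpow c 2^-1 * tau))) * sin (Im (- (2 * cpow c 2^-1 * tau)))).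
rewrite normrM (ger0_norm (expR_ge0 _)) ler_wpM2l ?expR_ge0//.
apply: le_trans (ler_norm_sin _) _; rewrite cImN normrN -mulrA.
by rewrite Im_mul2 normrM ger0_norm.
Qed.

(** As |lam| < 1, the number 1 - lam^2 lies in the right half-plane: the denominators do not vanish
    and the principal power in [w1] is differentiable. *)
Lemma admissible_Re_sub c tau : admissible c tau -> 0 < Re (1 - lam c tau ^+ 2).
Proof.
move=> [a0 _]; have l1 : normc (lam c tau) < 1.
  by rewrite normc_lam expR_lt1 oppr_lt0 mulr_gt0.
have : normc (lam c tau ^+ 2) < 1 by rewrite normcX expr_lt1 ?normc_ge0.
have := ler_Re_normc (lam c tau ^+ 2); have := ler_norm (Re (lam c tau ^+ 2)).
by rewrite cReD cReN /=; lra.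
Qed.

Lemma Re_mul_sub_conj (s l : R[i]) :
  Re (s * (1 - l) * (1 + l)^*) =
  Re s * (1 - normc l ^+ 2) + 2 * (Im s * Im l).
Proof. by case: s l => [p q] [m n]; rewrite sqr_normcE !cReImE /=; ring. Qed.

Lemma Re_mul_add_conj (s l : R[i]) :
  Re (s * (1 + l) * (1 - l)^*) =
  Re s * (1 - normc l ^+ 2) - 2 * (Im s * Im l).
Proof. by case: s l => [p q] [m n]; rewrite sqr_normcE !cReImE /=; ring. Qed.

Lemma admissible_w c tau : 0 < Re c -> admissible c tau ->
  `|Re (w3 c tau)| / 2 < Re (w2 c tau).
Proof.
move=> c0 adm; have [a0 bq] := adm.
have nz := admissible_Re_sub _ _ adm.
set s := cpow c 2^-1 in a0 bq *; have p0 : 0 < Re s := Re_cpow2V_gt0 _ c0.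
set l := lam c tau in nz *.
have l2 : 1 - l ^+ 2 != 0 by apply: contraTneq nz => ->; rewrite ltxx.
have l2E : 1 - l ^+ 2 = (1 - l) * (1 + l) by ring.
have [lm lp] : 1 - l != 0 /\ 1 + l != 0.
  by apply/andP; move: l2; rewrite l2E mulf_eq0 negb_or.
pose rho := normc l.
have rhoE : rho = expR (- (2 * Re (s * tau))) by exact: normc_lam.
have rho0 : 0 < rho by rewrite rhoE expR_gt0.
have key : 2 * `|Im s| * `|Im l| < Re s * (1 - rho ^+ 2).
  have h1 : 2 * `|Im s| * `|Im l| <= 4 * rho * (Re (s * tau) * Re s).
    have := Im_lam_le c tau; rewrite -/l -/s -/rho => h.
    apply: (@le_trans _ _ (2 * `|Im s| * (rho * (2 * `|Im (s * tau)|)))).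
      by rewrite ler_wpM2l// mulr_ge0.
    move: bq; rewrite normrM => bq.
    have := ler_wpM2l (ltW rho0) bq; lra.
  (* The inequality 4a < exp (2a) - exp (-2a) multiplied by rho = exp (-2a). *)
  have h2 : 4 * Re (s * tau) * rho < 1 - rho ^+ 2.
    have := sinh_gt_id (2 * Re (s * tau)); rewrite mulr_gt0// -rhoE => /(_ isT) h.
    have rr : expR (2 * Re (s * tau)) * rho = 1 by rewrite rhoE -expRD subrr expR0.
    have := mulr_gt0 (_ : 0 < expR (2 * Re (s * tau)) - rho - 2 * (2 * Re (s * tau))) rho0.
    by rewrite subr_gt0 h => /(_ isT); rewrite !mulrBl rr expr2; lra.
  have := ltr_pM2l p0 (4 * Re (s * tau) * rho) (1 - rho ^+ 2); rewrite h2 => h3.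
  by apply: le_lt_trans h1 _; lra.
have qn : `|2 * (Im s * Im l)| < Re s * (1 - rho ^+ 2).
  by rewrite normrM normrM ger0_norm// mulrA.
move: qn; rewrite ltr_norml => /andP[qn1 qn2].
have two0 : (2 : R[i]) != 0 by rewrite pnatr_eq0.
have half : (2^-1 : R[i]) = (2^-1 : R)%:C by rewrite fmorphV rmorph_nat.
have Re_half (x : R[i]) : Re (x / 2) = Re x / 2 by rewrite half cReM /= mulr0 subr0.
have minus : 0 < Re (w2 c tau) - Re (w3 c tau) / 2.
  rewrite -Re_half -cReN -cReD.
  have -> : w2 c tau - w3 c tau / 2 = s * (1 - l) / (1 + l) / 2.
    rewrite /w2 /w3 -/s -/l l2E.
    by field; rewrite lm lp.
  rewrite Re_half Re_div// !divr_gt0// ?exprn_gt0 ?normc_gt0//.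
  by rewrite Re_mul_sub_conj -/rho; lra.
have plus : 0 < Re (w2 c tau) + Re (w3 c tau) / 2.
  rewrite -Re_half -cReD.
  have -> : w2 c tau + w3 c tau / 2 = s * (1 + l) / (1 - l) / 2.
    rewrite /w2 /w3 -/s -/l l2E.
    by field; rewrite lm lp.
  rewrite Re_half Re_div// !divr_gt0// ?exprn_gt0 ?normc_gt0//.
  by rewrite Re_mul_add_conj -/rho; lra.
have : `|Re (w3 c tau)| < 2 * Re (w2 c tau).
  by rewrite ltr_norml; apply/andP; split; lra.
lra.
Qed.

(** Taking one of [cf], [tf] constant and the other the identity gives the two kinds of
    holomorphy. *)
Lemma cdiff_weights (cf tf : R[i] -> R[i]) z :
  cdiff cf z -> cdiff tf z -> 0 < Re (cf z) -> admissible (cf z) (tf z) ->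
  [/\ cdiff (fun w => w1 (cf w) (tf w)) z, cdiff (fun w => w2 (cf w) (tf w)) z &
    cdiff (fun w => w3 (cf w) (tf w)) z].
Proof.
move=> dc dt c0 adm; have nz := admissible_Re_sub _ _ adm.
have l2 : 1 - lam (cf z) (tf z) ^+ 2 != 0.
  by apply: contraTneq nz => ->; rewrite ltxx.
have two0 : (2 : R[i]) != 0 by rewrite pnatr_eq0.
have dpow a : cdiff (fun w => cpow (cf w) a) z.
  exact: (cdiff_comp cf (cpow ^~ a) z dc (cdiff_cpow _ a c0)).
have dexp f : cdiff f z -> cdiff (fun w => cexp (f w)) z.
  by move=> df; exact: (cdiff_comp f cexp z df (cdiff_cexp _)).
have dlam : cdiff (fun w => lam (cf w) (tf w)) z.
  have d2s := cdiffM _ _ z (cdiff_cst 2 z) (dpow 2^-1).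
  exact: (dexp _ (cdiffN _ z (cdiffM _ _ z d2s dt))).
have dlam2 : cdiff (fun w => lam (cf w) (tf w) ^+ 2) z := cdiffM _ _ z dlam dlam.
have dsub : cdiff (fun w => 1 - lam (cf w) (tf w) ^+ 2) z :=
  cdiffD _ _ z (cdiff_cst 1 z) (cdiffN _ z dlam2).
split.
- pose g w := pi%:C * (1 - lam (cf w) (tf w) ^+ 2) : R[i].
  have g0 : 0 < Re (g z) by rewrite /g cReM -[Re pi%:C]/pi mul0r subr0 mulr_gt0// pi_gt0.
  have dg : cdiff g z := cdiffM _ _ z (cdiff_cst _ z) dsub.
  have dgp := cdiff_comp g (cpow ^~ (- 2^-1)) z dg (cdiff_cpow _ _ g0).
  have dst := dexp _ (cdiffN _ z (cdiffM _ _ z (dpow 2^-1) dt)).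
  exact: (cdiffM _ _ z (cdiffM _ _ z (dpow 4^-1) dst) dgp).
- have dden := cdiffM _ _ z (cdiff_cst 2 z) dsub.
  have dnum := cdiffM _ _ z (dpow 2^-1) (cdiffD _ _ z (cdiff_cst 1 z) dlam2).
  exact: (cdiffM _ _ z dnum (cdiffV _ z dden (mulf_neq0 two0 l2))).
- have dnum := cdiffM _ _ z (cdiffM _ _ z (cdiff_cst 2 z) (dpow 2^-1)) dlam.
  exact: (cdiffM _ _ z dnum (cdiffV _ z dsub l2)).
Qed.

Lemma kernel_norm_differentiable (cf tf : R[i] -> R[i]) z :
  cdiff cf z -> cdiff tf z -> 0 < Re (cf z) -> admissible (cf z) (tf z) ->
  let F w := A (cf w) (tf w) in
  [/\ integral_operator_defined (K (cf z) (tf z)), hilbert_schmidt (F z),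
    opnorm (fun f x => F w f x - F z f x) @[w --> (z : R[i]^o)] --> 0%E &
    exists2 F' : (R -> R[i]) -> (R -> R[i]), bounded_operator F' &
      opnorm (fun f x => (F w f x - F z f x) / (w - z) - F' f x)
        @[w --> (z : R[i]^o)^'] --> 0%E].
Proof.
move=> dc dt c0 adm; have [d1 d2 d3] := cdiff_weights cf tf z dc dt c0 adm.
exact: (gauss_family_norm_differentiable _ _ _ z d1 d2 d3 (admissible_w _ _ c0 adm)).
Qed.

End Admissible.

(** * From the sectors to admissible parameters *)

Section Sectors.
Context {R : realType}.
Implicit Types (z w c tau : R[i]).

Lemma closure_Re_mul_ge0 (S : set R[i]^o) c tau :
  (forall w, S w -> 0 <= Re (c * w)) -> closure S tau -> 0 <= Re (c * tau).
Proof.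
move=> Sc cS; rewrite leNgt; apply/negP => ct.
(* If Re (c tau) were negative it would stay so on a disc of radius - Re (c tau) / (|c| + 1); the
   added 1 avoids division by zero. *)
have nc : 0 < normc c + 1 by have := normc_ge0 c; lra.
have [] := cS [set w : R[i]^o | normc (w - tau) < - Re (c * tau) / (normc c + 1)].
  by apply/near_normcP; exists (- Re (c * tau) / (normc c + 1)) => //; rewrite divr_gt0// oppr_gt0.
move=> w [/Sc cw /=]; rewrite ltr_pdivlMr// => wt.
have := ler_Re_normc (c * (w - tau)); rewrite normcM mulrBr cReD cReN.
have := ler_norm (Re (c * w) - Re (c * tau)).
have := normc_ge0 (w - tau); lra.
Qed.

Lemma Re_mul_arg c w : c != 0 -> w != 0 ->
  Re (c * w) = normc c * normc w * cos (arg c + arg w).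
Proof.
move=> c0 w0; rewrite cReM -(cos_arg c c0) -(cos_arg w w0) -(sin_arg c c0) -(sin_arg w w0) cosD.
ring.
Qed.

Lemma Re_gt0_of_arg w : w != 0 -> - (pi / 2) < arg w < pi / 2 -> 0 < Re w.
Proof.
by move=> w0 aw; rewrite -cos_arg// mulr_gt0 ?normc_gt0// cos_gt0_pihalf.
Qed.

Lemma Re_mul_arg_ge0 c w : c != 0 -> w != 0 ->
  - (pi / 2) < arg c + arg w < pi / 2 -> 0 <= Re (c * w).
Proof.
move=> c0 w0 aw; rewrite Re_mul_arg// mulr_ge0 ?mulr_ge0 ?normc_ge0//.
exact/ltW/cos_gt0_pihalf.
Qed.

Lemma arg_sgn_Im c : (0 < Im c -> 0 <= arg c) /\ (Im c < 0 -> arg c <= 0).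
Proof.
have h := acos_ge0 (Re_div_normc_itv c); rewrite /arg.
split=> i0; first by rewrite (ltW i0).
by rewrite (leNgt 0 (Im c)) i0 /= oppr_le0.
Qed.

(** Nonnegativity of ap + bq and ap - bq gives |bq| <= ap and a >= 0. If a = 0 then bq = 0; as Im c
    = 2pq is nonzero, b = 0 and tau = 0, which is excluded. *)
Lemma admissible_of_Re_ge0 c tau : 0 < Re c -> Im c != 0 -> tau != 0 ->
  0 <= Re tau -> 0 <= Re (c * tau) -> admissible c tau.
Proof.
move=> c0 i0 t0 rt rct; rewrite /admissible.
have cn0 : c != 0 by apply: contraTneq c0 => ->; rewrite ltxx.
have p0 := Re_cpow2V_gt0 _ c0; have ss := sqr_cpow2V _ cn0.
set s := cpow c 2^-1 in p0 ss *; set u := s * tau.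
have iE : Im c = 2 * Re s * Im s by rewrite -ss expr2 cImM; ring.
have q0 : Im s != 0 by apply: contraNneq i0; rewrite iE => ->; rewrite mulr0.
have h1 : 0 <= Re u * Re s + Im u * Im s.
  have -> : Re u * Re s + Im u * Im s = normc s ^+ 2 * Re tau.
    by rewrite /u cReM cImM sqr_normcE; ring.
  by rewrite mulr_ge0 ?sqr_ge0.
have h2 : 0 <= Re u * Re s - Im u * Im s.
  by move: rct; rewrite -ss expr2 -mulrA -/u cReM; lra.
have bq : `|Im u * Im s| <= Re u * Re s by rewrite ler_norml; apply/andP; split; lra.
split=> //; rewrite lt_neqAle; apply/andP; split; last first.
  by have := le_trans (normr_ge0 _) bq; rewrite pmulr_lge0.
apply/eqP => a0; move: bq; rewrite -a0 mul0r normr_le0 mulf_eq0 (negbTE q0) orbF => /eqP b0.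
have : u == 0 by apply/eqP/complexP.
rewrite mulf_eq0 (negbTE t0) orbF => /eqP s0.
by move: p0; rewrite s0 ltxx.
Qed.

Lemma admissible_S_ c tau : 0 < Re c -> S_ c tau -> admissible c tau.
Proof.
move=> c0; have cn0 : c != 0 by apply: contraTneq c0 => ->; rewrite ltxx.
have /andP[ac1 ac2] := arg_Re_gt0 c c0; have [sg1 sg2] := arg_sgn_Im c.
(* The four bounds keep both arg w and arg c + arg w in the open interval from -pi/2 to pi/2, so Re
   w and Re (c w) are nonnegative on the sector, hence on its closure. *)
have sect a b : - (pi / 2) <= a -> b <= pi / 2 -> - (pi / 2) - arg c <= a -> b <= pi / 2 - arg c ->
    Im c != 0 -> (closure (sector a b) `\ 0) tau -> admissible c tau.
  move=> h1 h2 h3 h4 i0 [cS /eqP t0]; apply: admissible_of_Re_ge0 => //.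
    rewrite -[tau]mul1r; apply: closure_Re_mul_ge0 cS => w [w0 /andP[aw1 aw2]].
    by rewrite mul1r ltW// Re_gt0_of_arg//; apply/andP; split; lra.
  apply: closure_Re_mul_ge0 cS => w [w0 /andP[aw1 aw2]].
  by apply: Re_mul_arg_ge0 => //; apply/andP; split; lra.
rewrite /S_; case: ifPn => [i0|i0].
  by apply: sect; rewrite ?gt_eqF//; have := sg1 i0; lra.
case: ifPn => [i1|i1].
  by apply: sect; rewrite ?lt_eqF//; have := sg2 i1; lra.
(* For real c, 2pq = 0 and p > 0 force q = 0, and admissibility reduces to Re tau > 0. *)
have Ic : Im c = 0 by apply/eqP; rewrite eq_le !leNgt i0 i1.
move=> [t0 at_]; have rt := Re_gt0_of_arg tau t0 at_.
have p0 := Re_cpow2V_gt0 _ c0; have ss := sqr_cpow2V _ cn0.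
rewrite /admissible; set s := cpow c 2^-1 in p0 ss *.
have q0 : Im s = 0.
  apply/eqP; have : 2 * Re s * Im s == 0.
    by rewrite -Ic -ss expr2 cImM; apply/eqP; ring.
  by rewrite mulf_eq0 mulf_eq0 (gt_eqF p0) pnatr_eq0.
rewrite q0 mulr0 normr0 cReM q0 mul0r subr0.
by split; [exact: mulr_gt0|exact: ltW (mulr_gt0 (mulr_gt0 p0 rt) p0)].
Qed.

(** For real tau = t one has a = tp and b = tq, so the condition reads q^2 <= p^2, and p^2 - q^2 =
    Re c. *)
Lemma admissible_pos c (t : R) : 0 < Re c -> 0 < t -> admissible c t%:C.
Proof.
move=> c0 t0; have cn0 : c != 0 by apply: contraTneq c0 => ->; rewrite ltxx.
have p0 := Re_cpow2V_gt0 _ c0; have ss := sqr_cpow2V _ cn0.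
rewrite /admissible; set s := cpow c 2^-1 in p0 ss *.
rewrite cReM cImM mulr0 mulr0 subr0 add0r -[Re t%:C]/t.
split; first by rewrite mulr_gt0.
have : 0 < Re s ^+ 2 - Im s ^+ 2.
  by move: c0; rewrite -{1}ss expr2 cReM.
move: (Re _) (Im _) p0 => p q p0 pq.
rewrite mulrAC normrM (gtr0_norm t0) mulrAC ler_wpM2r ?(ltW t0)//.
by rewrite -!expr2 ger0_norm ?sqr_ge0//; lra.
Qed.

End Sectors.

Theorem lemma9 (R : realType) :
  [/\ forall c tau : R[i], 0 < complex.Re c -> S_ c tau ->
        integral_operator_defined (K c tau) /\ hilbert_schmidt (A c tau),
      forall c : R[i], 0 < complex.Re c ->
        norm_continuous_on (S_ c) (fun tau => A c tau) /\
        norm_holomorphic_on (interior (S_ c)) (fun tau => A c tau) &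
      forall t : R, 0 < t ->
        norm_holomorphic_on [set c : R[i]^o | 0 < complex.Re c]
          (fun c => A c t%:C)].
Proof.
have main (c tau : R[i]) (c0 : 0 < Re c) (Sct : S_ c tau) :=
  kernel_norm_differentiable (fun=> c) (fun w => w) tau
    (cdiff_cst c tau) (cdiff_id tau) c0 (admissible_S_ c tau c0 Sct).
split=> [c tau c0 Sct|c c0|t t0 c c0].
- by have [] := main c tau c0 Sct.
- split=> tau.
    move=> Sct; have [_ [bd _] cv _] := main c tau c0 Sct.
    by split=> //; apply: cvg_trans cv; apply: cvg_app; exact: cvg_within.
  by move=> /interior_subset Sct; have [_ [bd _] _ hol] := main c tau c0 Sct.
- have [_ [bd _] _ hol] := kernel_norm_differentiable (fun w => w) (fun=> t%:C) c
    (cdiff_id c) (cdiff_cst _ c) c0 (admissible_pos c t c0 t0).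
  by split.
Qed.
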